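(* Let $\Delta$ be a $1$-dimensional flag simplicial complex on $[n]$ and let $p$ be an integer with $2\le p\le\nu(\overline\Delta)$. Assume that $\dim S/I_\Delta^{[p]}=2p$. Then: (1) The set $\mathcal F_{2p-1}(\Delta^{[p]})$ of $(2p-1)$-dimensional facets of $\Delta^{[p]}$ is $$\mathcal F_{2p-1}(\Delta^{[p]})=\begin{cases}\mathcal F(\Delta,K_{1,2p-1})\cup\mathcal F(\Delta,K_{3,2p-3})\cup\dots\cup\mathcal F(\Delta,K_{p,p}) & \text{if } p\text{ is odd},\\ \mathcal F(\Delta,K_{1,2p-1})\cup\mathcal F(\Delta,K_{3,2p-3})\cup\dots\cup\mathcal F(\Delta,K_{p-1,p+1}) & \text{if } p\text{ is even}.\end{cases}$$ (2) $\Delta^{[p]}$ is pure if and only if one of the following holds for some integers $k,\ell$: (i) $\Delta\cong K_{2k+1,2\ell+1}$ and $n=(2k+1)+(2\ell+1)\ge 2p$; (ii) $\Delta\cong K_{2k+1,2\ell}$ and $\ell\ge p$; (iii) $\Delta\cong K_{2k,2\ell}$ and $k,\ell\ge p$. (3) $\Delta^{[p]}$ is Cohen--Macaulay if and only if $\Delta\cong K_{1,n-1}$ and $n>2p$.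
   Context: A $1$-dimensional flag simplicial complex $\Delta$ on $[n]=\{1,\dots,n\}$ is a $1$-dimensional simplicial complex whose Stanley--Reisner ideal $I_\Delta$ is generated in degree two; equivalently, a triangle-free graph on the vertex set $[n]$ (with at least one edge, isolated vertices allowed). $\overline{\Delta}$ denotes the complement graph on $[n]$, so $I_\Delta=(x_ix_j:\{i,j\}\in E(\overline\Delta))$ is the edge ideal of $\overline\Delta$ in $S=K[x_1,\dots,x_n]$, where $K$ is an arbitrary field. $\nu(\overline\Delta)$ is the largest size of a matching (set of pairwise disjoint edges) of $\overline\Delta$. The squarefree power $I_\Delta^{[p]}$ is generated by the squarefree monomials among the minimal generators of $I_\Delta^p$, i.e. by the products of the variables indexed by the $2p$ vertices of the $p$-matchings of $\overline\Delta$. $\Delta^{[p]}$ denotes the simplicial complex on $[n]$ whose Stanley--Reisner ideal is $I_\Delta^{[p]}$. For $F\subseteq[n]$, $\Delta_F$ is the induced subgraph of $\Delta$ on $F$; $\mathcal F(\Delta,K_{i,j})=\{F\subseteq[n] : \Delta_F\cong K_{i,j}\}$, where $K_{i,j}$ is the complete bipartite graph with parts of sizes $i,j\geq 1$. $\Delta^{[p]}$ is pure if all its facets have the same dimension, and Cohen--Macaulay (over $K$) if $S/I_\Delta^{[p]}$ is Cohen--Macaulay. $\dim$ of a ring is Krull dimension. *)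

(* Defs.v *)
From mathcomp Require Import all_boot all_order all_algebra.
From mathcomp Require Import boolp.
From mathcomp Require Import mpoly.

Set Implicit Arguments.
Unset Strict Implicit.
Unset Printing Implicit Defensive.

Import GRing.Theory.
Local Open Scope ring_scope.

(** * Ideals, Krull dimension *)

Section Ideals.
Variable R : comNzRingType.
Implicit Types (I P : R -> Prop) (d : nat).

Definition ideal I : Prop :=
  [/\ I 0, forall f g, I f -> I g -> I (f + g) & forall h f, I f -> I (h * f)].

Definition ideal_gen (G : R -> Prop) : R -> Prop := fun f =>
  exists s : seq (R * R),
    (forall u, u \in s -> G u.2) /\ f = \sum_(u <- s) u.1 * u.2.

Definition ideal_pow I (p : nat) : R -> Prop :=
  ideal_gen (fun f => exists g : 'I_p -> R,
    (forall i, I (g i)) /\ f = \prod_(i < p) g i).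

Definition prime_ideal P : Prop :=
  [/\ ideal P, ~ P 1 & forall f g, P (f * g) -> P f \/ P g].

Definition strict_sub P Q : Prop :=
  (forall f, P f -> Q f) /\ exists f, Q f /\ ~ P f.

(* A chain P_0 < ... < P_d of prime ideals of R/I, each given by its preimage
   in R. *)
Definition prime_chain_quot I d : Prop :=
  exists P : 'I_d.+1 -> R -> Prop,
    [/\ forall i, prime_ideal (P i),
        forall i f, I f -> P i f &
        forall i j : 'I_d.+1, (i < j)%N -> strict_sub (P i) (P j)].

Definition krull_dim_quot I d : Prop :=
  prime_chain_quot I d /\ forall e, prime_chain_quot I e -> (e <= d)%N.

(* [h * s`_i = 0 -> h = 0] in R/(I + (s_0, ..., s_{i-1})), and
   R/(I + (s)) is nonzero. *)
Definition regular_seq_quot I (s : seq R) : Prop :=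
  (forall i, (i < size s)%N -> forall h,
     ideal_gen (fun g => I g \/ g \in take i s) (h * s`_i) ->
     ideal_gen (fun g => I g \/ g \in take i s) h)
  /\ ~ ideal_gen (fun g => I g \/ g \in s) 1.

End Ideals.

(** * Homogeneous ideals of the polynomial ring S = K[x_1, ..., x_n] *)

Section Polynomials.
Variables (K : fieldType) (n : nat).
Implicit Types (I : {mpoly K[n]} -> Prop) (m : 'X_{1..n}).

Definition generated_in_degree I (d : nat) : Prop :=
  forall f, I f -> ideal_gen (fun g => I g /\ g \is d.-homog) f.

Definition graded_max_ideal : {mpoly K[n]} -> Prop :=
  ideal_gen (fun g => exists i : 'I_n, g = 'X_i).

Definition homog_regular_seq I (s : seq {mpoly K[n]}) : Prop :=
  (forall f, f \in s -> graded_max_ideal f /\ exists d, f \is d.-homog)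
  /\ regular_seq_quot I s.

(* Depth of the standard graded algebra S/I, for a proper homogeneous ideal I. *)
Definition depth_quot I (d : nat) : Prop :=
  (exists2 s, homog_regular_seq I s & size s = d)
  /\ forall s, homog_regular_seq I s -> (size s <= d)%N.

Definition cohen_macaulay_quot I : Prop :=
  exists2 d, krull_dim_quot I d & depth_quot I d.

(* Exponents of the minimal monomial generators of a monomial ideal;
   [<=] on 'X_{1..n} is divisibility of monomials. *)
Definition min_gen I m : Prop :=
  I 'X_[m] /\ forall m', I 'X_[m'] -> (m' <= m)%MM -> m' = m.

Definition squarefree m : Prop := forall i, (m i <= 1)%N.

Definition sqfree_power I (p : nat) : {mpoly K[n]} -> Prop :=
  ideal_gen (fun g => exists m,
    [/\ g = 'X_[m], squarefree m & min_gen (ideal_pow I p) m]).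

Definition xset (F : {set 'I_n}) : {mpoly K[n]} := \prod_(i in F) 'X_i.

Definition SR_ideal (Delta : {set {set 'I_n}}) : {mpoly K[n]} -> Prop :=
  ideal_gen (fun g => exists2 F : {set 'I_n}, F \notin Delta & g = xset F).

(* The simplicial complex whose Stanley-Reisner ideal is the squarefree
   monomial ideal I. *)
Definition SR_complex I : {set {set 'I_n}} := [set F | ~~ `[< I (xset F) >]].

End Polynomials.

Arguments SR_ideal K {n} Delta.

(** * Graphs *)

Definition graph_iso (T U : finType) (e : rel T) (e' : rel U) : Prop :=
  exists2 f : T -> U, bijective f & forall x y, e' (f x) (f y) = e x y.

Definition complete_bipartite (i j : nat) : rel ('I_i + 'I_j) :=
  fun u v => match u, v with
             | inl _, inr _ | inr _, inl _ => true
             | _, _ => false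
             end.

Definition induced (T : finType) (e : rel T) (F : {set T}) :
  rel {x : T | x \in F} := fun u v => e (val u) (val v).

Definition complement (T : finType) (e : rel T) : rel T :=
  fun x y => (x != y) && ~~ e x y.

Definition edges (T : finType) (e : rel T) : {set {set T}} :=
  [set A | [exists x, exists y, e x y && (A == [set x; y])]].

Definition matching_number (T : finType) (e : rel T) : nat :=
  \max_(M : {set {set T}} | (M \subset edges e) && trivIset M) #|M|.

(** * Simplicial complexes on {0, ..., n-1} *)

Section Complexes.
Variable n : nat.
Implicit Types (Delta : {set {set 'I_n}}) (F G : {set 'I_n}) (d : nat).

Definition simplicial_complex Delta : Prop :=
  (forall i : 'I_n, [set i] \in Delta)
  /\ forall F G, G \in Delta -> F \subset G -> F \in Delta.

Definition complex_dim Delta d : Prop :=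
  (exists2 F, F \in Delta & #|F| = d.+1)
  /\ forall F, F \in Delta -> (#|F| <= d.+1)%N.

Definition flag (K : fieldType) Delta : Prop :=
  generated_in_degree (SR_ideal K Delta) 2.

Definition facets Delta : {set {set 'I_n}} :=
  [set F | maxset [pred G in Delta] F].

Definition facets_of_dim Delta d : {set {set 'I_n}} :=
  [set F in facets Delta | #|F| == d.+1].

Definition pure Delta : Prop :=
  forall F G, F \in facets Delta -> G \in facets Delta -> #|F| = #|G|.

Definition skeleton_graph Delta : rel 'I_n :=
  fun x y => (x != y) && ([set x; y] \in Delta).

Definition bipartite_subsets Delta (i j : nat) : {set {set 'I_n}} :=
  [set F | `[< graph_iso (induced (skeleton_graph Delta) (F := F))
                         (@complete_bipartite i j) >]].

Definition sqfree_power_complex (K : fieldType) Delta (p : nat) :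
    {set {set 'I_n}} :=
  SR_complex (sqfree_power (SR_ideal K Delta) p).

End Complexes.

(* Main.v *)
From HB Require Import structures.
Require Import Defs.
From mathcomp Require Import all_boot all_order all_algebra.
From mathcomp Require Import boolp mpoly ring zify.

(** Let [G] be the graph of [Delta] and [H] its complement. A set [F] is a face
    of [Delta^[p]] iff [H] has no [p]-matching inside [F], so the Krull dimension
    hypothesis says that the largest such sets have [2p] elements. As [G] is
    triangle-free, the only obstruction to a perfect matching of [H] on a set of
    even size is that [G] is complete bipartite on it with two odd parts, which
    gives (1). As all sets of [2p - 1] vertices are faces, purity means that each
    of them extends to such a set; this forces [G] to be complete bipartite, and
    a parity count gives (2).

    For (3), any polynomials [f_1, ..., f_k] satisfy, modulo a monomial ideal
    whose faces have fewer than [k] vertices, a relation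
    [f_1^a_1 (f_2^a_2 (... (1 + ...) + b_2 f_2) + b_1 f_1)] (count monomials).
    Along a chain of primes such a relation is absurd, and along a homogeneous
    regular sequence it is a nonzerodivisor; this bounds both the Krull dimension
    and the depth, the latter by the size of every facet, so Cohen-Macaulay
    implies pure. If both parts of [G] have at least two vertices, some face with
    [2p - 2] vertices has a disconnected link, and a section supported on one
    component of that link contradicts depth [2p]. For a star, [S/I] is a
    polynomial ring in one variable over the squarefree Veronese quotient, where
    the elementary symmetric polynomials in decreasing degree form a regular
    sequence over any field. *)

Set Implicit Arguments.
Unset Strict Implicit.
Unset Printing Implicit Defensive.

Import GRing.Theory.

(** * Regular sequences *)

Section RegularSequences.
Local Open Scope ring_scope.
Variable R : comNzRingType.
Implicit Types (J Q : R -> Prop) (f g h u v w y : R) (s : seq R).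

Lemma ideal_zero J : ideal J -> J 0. Proof. by case. Qed.
Lemma ideal_add J f g : ideal J -> J f -> J g -> J (f + g).
Proof. by case=> _ D _; apply: D. Qed.
Lemma ideal_mull J f g : ideal J -> J g -> J (f * g).
Proof. by case=> _ _; apply. Qed.
Lemma ideal_mulr J f g : ideal J -> J f -> J (f * g).
Proof. by rewrite mulrC; apply: ideal_mull. Qed.
Lemma ideal_opp J f : ideal J -> J f -> J (- f).
Proof. by rewrite -mulN1r; apply: ideal_mull. Qed.
Lemma ideal_sub J f g : ideal J -> J f -> J g -> J (f - g).
Proof. by move=> iJ Jf Jg; apply: ideal_add => //; apply: ideal_opp. Qed.
Lemma ideal_addKl J f g : ideal J -> J f -> J (f + g) -> J g.
Proof.
move=> iJ Jf Jfg; have -> : g = (f + g) - f by ring.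
exact: ideal_sub.
Qed.
Lemma ideal_sum (I : eqType) (r : seq I) (F : I -> R) J :
  ideal J -> (forall i, i \in r -> J (F i)) -> J (\sum_(i <- r) F i).
Proof.
move=> iJ JF; rewrite big_seq; elim/big_ind: _ => [|f g|i /JF //].
  exact: ideal_zero.
exact: ideal_add.
Qed.

Lemma ideal_eqr J f g : ideal J -> J (f - g) -> J f <-> J g.
Proof.
move=> iJ Jfg; split=> [Jf|Jg].
  by rewrite -(subKr f g); apply: ideal_sub.
by rewrite -(subrK g f); apply: ideal_add.
Qed.

Lemma ideal_gen_ideal (G : R -> Prop) : ideal (ideal_gen G).
Proof.
split.
- by exists [::]; split=> //; rewrite big_nil.
- move=> f g [s [Gs ->]] [t [Gt ->]]; exists (s ++ t); split.
    by move=> u; rewrite mem_cat => /orP[/Gs|/Gt].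
  by rewrite big_cat.
- move=> h f [s [Gs ->]]; exists [seq (h * u.1, u.2) | u : R * R <- s]; split.
    by move=> _ /mapP[u /Gs Gu ->].
  by rewrite big_map mulr_sumr; apply: eq_bigr => u _; rewrite mulrA.
Qed.

Lemma ideal_gen_mem (G : R -> Prop) g : G g -> ideal_gen G g.
Proof.
move=> Gg; exists [:: (1, g)]; split; last by rewrite big_seq1 mul1r.
by move=> u; rewrite inE => /eqP->.
Qed.

Lemma ideal_gen_min (G : R -> Prop) J f :
  ideal J -> (forall g, G g -> J g) -> ideal_gen G f -> J f.
Proof.
move=> iJ GJ [s [Gs ->]]; apply: ideal_sum => // u /Gs /GJ.
exact: ideal_mull.
Qed.

Definition add_gen J f : R -> Prop := fun g => exists a, J (g - a * f).
Definition colon J u : R -> Prop := fun g => J (u * g).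
Definition nonzerodiv J f := forall h, J (f * h) -> J h.

(** Regularity without the nonvanishing of the last quotient, so that inductions can pass to colon
    ideals, which may be the whole ring. *)
Fixpoint wregular J s :=
  if s is f :: s' then nonzerodiv J f /\ wregular (add_gen J f) s' else True.

Lemma add_gen_ideal J f : ideal J -> ideal (add_gen J f).
Proof.
move=> iJ; split.
- by exists 0; rewrite mul0r subr0; apply: ideal_zero.
- move=> g h [a Ja] [b Jb]; exists (a + b).
  have -> : g + h - (a + b) * f = (g - a * f) + (h - b * f) by ring.
  exact: ideal_add.
- move=> h g [a Ja]; exists (h * a).
  have -> : h * g - h * a * f = h * (g - a * f) by ring.
  exact: ideal_mull.
Qed.

Lemma sub_add_gen J f g : J g -> add_gen J f g.
Proof. by exists 0; rewrite mul0r subr0. Qed.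

Lemma add_genM J f a : ideal J -> add_gen J f (a * f).
Proof. by move=> iJ; exists a; rewrite subrr; apply: ideal_zero. Qed.

Lemma add_gen_id J f : ideal J -> add_gen J f f.
Proof. by move=> iJ; rewrite -[X in add_gen _ _ X]mul1r; apply: add_genM. Qed.

Lemma add_gen_min J Q f g : ideal Q -> (forall h, J h -> Q h) -> Q f ->
  add_gen J f g -> Q g.
Proof.
move=> iQ JQ Qf [a /JQ Qa]; rewrite -(subrK (a * f) g).
by apply: ideal_add => //; apply: ideal_mull.
Qed.

Lemma predext J Q : (forall g, J g <-> Q g) -> J = Q.
Proof. by move=> JQ; apply/funext => g; apply/propext. Qed.

Lemma add_genAC J f g : ideal J ->
  add_gen (add_gen J f) g = add_gen (add_gen J g) f.
Proof.
move=> iJ; apply: predext => h.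
by split; case=> a [b Jb]; exists b; exists a; move: Jb; congr J; ring.
Qed.

Lemma add_gen_congr J f g : ideal J -> J (f - g) -> add_gen J f = add_gen J g.
Proof.
move=> iJ Jfg; apply: predext => h; split=> -[a Ja]; exists a.
  have -> : h - a * g = (h - a * f) + a * (f - g) by ring.
  by apply: ideal_add => //; apply: ideal_mull.
have -> : h - a * f = (h - a * g) - a * (f - g) by ring.
by apply: ideal_sub => //; apply: ideal_mull.
Qed.

Lemma foldl_add_gen_ideal J s : ideal J -> ideal (foldl add_gen J s).
Proof. by elim: s J => //= f s IHs J iJ; apply/IHs/add_gen_ideal. Qed.

Lemma ideal_gen_add J s : ideal J ->
  ideal_gen (fun g => J g \/ g \in s) = foldl add_gen J s.
Proof.
move=> iJ; apply: predext => g; split.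
  apply: ideal_gen_min; first exact: foldl_add_gen_ideal.
  elim: s J iJ {g} => [|f s IHs] J iJ g /=; first by case.
  case=> [Jg|]; last rewrite inE => /predU1P[->|gs].
  - by apply: IHs; [apply: add_gen_ideal|left; apply: sub_add_gen].
  - by apply: IHs; [apply: add_gen_ideal|left; apply: add_gen_id].
  - by apply: IHs; [apply: add_gen_ideal|right].
suff H Q : ideal Q -> (forall h, J h -> Q h) -> (forall h, h \in s -> Q h) ->
    foldl add_gen J s g -> Q g.
  apply: H => [|h Jh|h hs]; first exact: ideal_gen_ideal.
    by apply: ideal_gen_mem; left.
  by apply: ideal_gen_mem; right.
move=> iQ JQ; elim: s J iJ JQ => [|f s IHs] J iJ JQ sQ /=; first exact: JQ.
apply: IHs; first exact: add_gen_ideal.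
  by move=> h; apply: add_gen_min => //; apply: sQ; rewrite mem_head.
by move=> h hs; apply: sQ; rewrite inE hs orbT.
Qed.

Lemma wregularP J s : ideal J ->
  wregular J s <->
  forall i, (i < size s)%N -> nonzerodiv (foldl add_gen J (take i s)) s`_i.
Proof.
elim: s J => [|f s IHs] J iJ /=; first by split.
have iJf := add_gen_ideal f iJ; split.
  by case=> nf /(IHs _ iJf) ns [|i] //= /ns.
by move=> ns; split; [apply: (ns 0%N)|apply/IHs => // i /(ns i.+1)].
Qed.

Lemma regular_seq_quotP J s : ideal J ->
  regular_seq_quot J s <-> wregular J s /\ ~ foldl add_gen J s 1.
Proof.
move=> iJ; rewrite /regular_seq_quot ideal_gen_add //.
split=> -[H1 H2]; split=> //.
  apply/wregularP => // i lt_i h Jh; move/(_ i lt_i h): H1.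
  by rewrite ideal_gen_add // mulrC; apply.
move/(wregularP s iJ): H1 => H1 i /H1 nf h.
by rewrite ideal_gen_add // mulrC; apply: nf.
Qed.

Lemma wregular_take J s t : wregular J (s ++ t) -> wregular J s.
Proof. by elim: s J => //= f s IHs J [? /IHs]. Qed.

(** From the exact sequence [0 -> R/(J : y) -> R/J -> R/(J + y) -> 0]. *)
Lemma wregular_colon_add J y s : ideal J ->
  wregular (colon J y) s -> wregular (add_gen J y) s -> wregular J s.
Proof.
elim: s J => //= f s IHs J iJ [nc wc] [na wa].
have nf : nonzerodiv J f.
  move=> h Jfh; have [g Jg] : add_gen J y h by apply/na/sub_add_gen.
  rewrite -(subrK (g * y) h); apply: ideal_add => //.
  rewrite mulrC; apply: nc; rewrite /colon.
  have -> : y * (f * g) = f * h - f * (h - g * y) by ring.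
  by apply: ideal_sub => //; apply: ideal_mull.
split=> //; apply: IHs; first exact: add_gen_ideal.
(* Since [f] is a nonzerodivisor modulo [J + (y)], a congruence [y * g = a * f] modulo [J] makes [a]
   a multiple of [y] modulo [J]. *)
- suff -> : colon (add_gen J f) y = add_gen (colon J y) f by [].
  apply: predext => g; split; rewrite /colon => -[a Ja].
    have [b Jb] : add_gen J y a.
      apply: na; exists g; have -> : f * a - g * y = - (y * g - a * f) by ring.
      exact: ideal_opp.
    exists b; rewrite /colon.
    have -> : y * (g - b * f) = (y * g - a * f) + f * (a - b * y) by ring.
    by apply: ideal_add => //; apply: ideal_mull.
  by exists (y * a); move: Ja; congr J; ring.
- by rewrite add_genAC.
Qed.

Lemma wregular_map_congr (I : eqType) (r : seq I) (F G : I -> R) J :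
  ideal J -> (forall i, i \in r -> J (F i - G i)) ->
  wregular J (map F r) -> wregular J (map G r).
Proof.
move=> iJ; elim: r J iJ => //= i r IHr J iJ JFG [nF wF].
have JFGi : J (F i - G i) by apply: JFG; rewrite mem_head.
split.
  move=> h Jh; apply: nF.
  apply/(@ideal_eqr _ _ (G i * h) iJ) => //.
  by rewrite -mulrBl; apply: ideal_mulr.
rewrite -(add_gen_congr iJ JFGi); apply: IHr => //.
  exact: add_gen_ideal.
by move=> j rj; apply/sub_add_gen/JFG; rewrite inE rj orbT.
Qed.

(** [rho] plays the part of the substitution [y := 0], and [free_var J] says
    that [J] is extended from a subring over which [y] is a variable. *)
Section FreeVariable.
Variables (y : R) (rho : {rmorphism R -> R}).
Hypothesis rho_y : rho y = 0.
Hypothesis rho_mod : forall f, exists a, f - rho f = a * y.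

Definition free_var J :=
  [/\ ideal J, forall f, J f -> J (rho f) & nonzerodiv J y].

(** If [y * g - h * a] is in [J], applying [rho] puts [rho h * a] in [J]; what remains of [h * a] is
    a multiple of [y], and [y] cancels. *)
Lemma free_var_add_gen J a :
  rho a = a -> free_var J -> free_var (add_gen J a).
Proof.
move=> ra [iJ rJ nJ]; split; first exact: add_gen_ideal.
  by move=> f [b /rJ]; rewrite /= rmorphB rmorphM ra; exists (rho b).
move=> g [h Jh]; have := rJ _ Jh.
rewrite rmorphB !rmorphM rho_y mul0r ra => Jrh.
have [b hb] := rho_mod h; exists b; apply: nJ.
have -> : y * (g - b * a) = (y * g - h * a) - (0 - rho h * a).
  have -> : y * (g - b * a) = y * g - b * y * a by ring.
  by rewrite -hb; ring.
exact: ideal_sub.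
Qed.

Lemma wregular_add_var J s : free_var J -> (forall f, f \in s -> rho f = f) ->
  wregular J s -> wregular (add_gen J y) s.
Proof.
elim: s J => //= a s IHs J fJ rs [na wa]; have [iJ rJ nJ] := fJ.
have ra : rho a = a by apply: rs; rewrite mem_head.
split; last first.
  rewrite add_genAC //; apply: IHs => //; first exact: free_var_add_gen.
  by move=> f fs; apply: rs; rewrite inE fs orbT.
move=> h [b /rJ]; rewrite rmorphB !rmorphM ra rho_y mulr0 subr0 => /na Jh.
by have [c hc] := rho_mod h; exists c; rewrite -hc subKr.
Qed.

Fixpoint down k := if k is k'.+1 then k :: down k' else [::].

(** When the [a i] are elementary symmetric polynomials, the new entries are those with one more
    variable [y]. As [J] contains [a k.+1], the first entry is [y * a k] modulo [J]; after it, the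
    colon by [y] is [J + (a k)], where induction applies, and adding [y] gives [J + (y)], where the
    shifted terms vanish. *)
Lemma wregular_add_shift J k (a : nat -> R) :
  free_var J -> (forall i, rho (a i) = a i) -> a 0%N = 1 -> J (a k.+1) ->
  wregular J (map a (down k)) ->
  wregular J [seq a i + y * a i.-1 | i <- down k.+1].
Proof.
move=> fJ ra a0; elim: k J fJ => [|k IHk] J fJ Ja wa; have [iJ rJ nJ] := fJ.
  split=> // h; rewrite a0 mulr1 mulrDl => Jh; apply: nJ.
  by apply: ideal_addKl Jh => //; apply: ideal_mulr.
have {wa}[na wa] := wa.
have iJa := add_gen_ideal (a k.+1) iJ.
have iJya := add_gen_ideal (y * a k.+1) iJ.
have iJy := add_gen_ideal y iJ.
split.
  move=> h; rewrite mulrDl -mulrA => Jh; apply/na/nJ => /=.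
  by apply: ideal_addKl Jh => //; apply: ideal_mulr.
have -> : add_gen J (a k.+2 + y * a k.+1) = add_gen J (y * a k.+1).
  by apply: add_gen_congr => //; rewrite addrK.
apply: (@wregular_colon_add _ y) => //.
- have -> : colon (add_gen J (y * a k.+1)) y = add_gen J (a k.+1).
    apply: predext => g; split; rewrite /colon => -[b Jb]; exists b.
      by apply: nJ; move: Jb; congr J; ring.
    by have := ideal_mull y iJ Jb; congr J; ring.
  by apply: IHk => //; [apply: free_var_add_gen|apply: add_gen_id].
- have -> : add_gen (add_gen J (y * a k.+1)) y = add_gen J y.
    apply: predext => g; split; last by case=> b; exists b; apply: sub_add_gen.
    case=> b [c Jc]; exists (b + c * a k.+1); move: Jc; congr J; ring.
  apply: (@wregular_map_congr _ _ a) => // [i _|].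
    exists (- a i.-1); have -> : a i - (a i + y * a i.-1) - - a i.-1 * y = 0.
      by ring.
    exact: ideal_zero.
  by apply: wregular_add_var => // f /mapP[i _ ->].
Qed.

End FreeVariable.

(** A relation [f_1^k_1 (f_2^k_2 (... (c + ...) + a_2 f_2) + a_1 f_1)] with [c]
    invertible, as obtained from any nontrivial polynomial in the [f_i] by
    factoring out its lexicographically least monomial; [H] constrains the
    cofactors. *)
Fixpoint lex_rel (H : R -> Prop) s v :=
  if s is f :: s' then
    exists k a w, [/\ lex_rel H s' w, H (w + a * f) & v = f ^+ k * (w + a * f)]
  else exists c, c * v = 1.

Lemma lex_relW (H H' : R -> Prop) s v :
  (forall u, H u -> H' u) -> lex_rel H s v -> lex_rel H' s v.
Proof.
move=> HH'; elim: s v => //= f s IHs v [k [a [w [/IHs rw /HH' H'w ->]]]].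
by exists k, a, w.
Qed.

Lemma prime_idealX J f k : prime_ideal J -> J (f ^+ k) -> J f.
Proof.
case=> iJ J1 pJ; elim: k => [|k IHk]; first by rewrite expr0.
by rewrite exprS => /pJ[].
Qed.

(** If [v] is in [P 0], the power of [f_1], which is not in [P 0], cancels, and [a_1 f_1] drops out
    in [P 1]. Repeating this puts an invertible element in the last prime. *)
Lemma lex_rel_prime_chain (P : nat -> R -> Prop) s v H :
  (forall i, (i <= size s)%N -> prime_ideal (P i)) ->
  (forall i f, (i < size s)%N -> P i f -> P i.+1 f) ->
  (forall i, (i < size s)%N -> P i.+1 s`_i /\ ~ P i s`_i) ->
  lex_rel H s v -> ~ P 0%N v.
Proof.
elim: s v P => [|f s IHs] v P /= prP leP sP.
  case=> c cv Pv; have [iP P1 _] := prP _ (leqnn 0).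
  by apply: P1; rewrite -cv; apply: ideal_mull.
case=> k [a [w [rw _ ->]]] P0; have [_ _ pP0] := prP 0%N isT.
have [P1f nP0f] := sP 0%N isT.
have {}P0 : P 0%N (w + a * f).
  by case: (pP0 _ _ P0) => // /(prime_idealX (prP 0%N isT)).
have P1 := leP 0%N _ isT P0.
apply: (IHs w (fun i => P i.+1)) => //.
- by move=> i; apply: (prP i.+1).
- by move=> i g; apply: (leP i.+1).
- by move=> i; apply: (sP i.+1).
- have [iP _ _] := prP 1%N isT.
  by rewrite -(addrK (a * f) w); apply: ideal_sub => //; apply: ideal_mull.
Qed.

Lemma nonzerodivX J f k : nonzerodiv J f -> nonzerodiv J (f ^+ k).
Proof.
move=> nf; elim: k => [h|k IHk h]; first by rewrite expr0 mul1r.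
by rewrite exprS -mulrA => /nf /IHk.
Qed.

(** The quotient by [J + (f ^+ k)] is filtered by the powers of [f], with successive quotients
    isomorphic to [R/(J + (f))]. *)
Lemma nonzerodiv_add_genX J f w k z : ideal J -> nonzerodiv J f ->
  nonzerodiv (add_gen J f) w -> add_gen J (f ^+ k) (w * z) ->
  add_gen J (f ^+ k) z.
Proof.
move=> iJ nf nw; elim: k z => [|k IHk] z Jz.
  by exists z; rewrite expr0 mulr1 subrr; apply: ideal_zero.
have [z1 Jz1] : add_gen J f z.
  apply: nw; case: Jz => a Ja; exists (a * f ^+ k).
  by move: Ja; congr J; rewrite exprSr; ring.
have [b Jb] : add_gen J (f ^+ k) z1.
  apply: IHk; case: Jz => a Ja; exists a; apply: nf.
  have -> : f * (w * z1 - a * f ^+ k) =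
     (w * z - a * f ^+ k.+1) - w * (z - z1 * f) by rewrite exprS; ring.
  by apply: ideal_sub => //; apply: ideal_mull.
exists b; have -> : z - b * f ^+ k.+1 = (z - z1 * f) + f * (z1 - b * f ^+ k).
  by rewrite exprS; ring.
by apply: ideal_add => //; apply: ideal_mull.
Qed.

End RegularSequences.

(** * Ideals defined by supports *)

Section SquarefreeIdeals.
Local Open Scope ring_scope.
Variables (K : fieldType) (n : nat).
Implicit Types (m : 'X_{1..n}) (f g h u v w : {mpoly K[n]}).
Implicit Types (J Q : {mpoly K[n]} -> Prop) (U V : pred {set 'I_n}).
Implicit Types (E F G Z : {set 'I_n}).

Definition mnm_supp m : {set 'I_n} := [set i | m i != 0%N].

Lemma mnm_suppD m1 m2 : mnm_supp (m1 + m2) = mnm_supp m1 :|: mnm_supp m2.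
Proof. by apply/setP => i; rewrite !inE mnmDE addn_eq0 negb_and. Qed.

Lemma mnm_supp_mesym1 F : mnm_supp (mesym1 F) = F.
Proof. by apply/setP => i; rewrite inE mnmE; case: (i \in F). Qed.

Lemma mnm_suppU i : mnm_supp U_(i) = [set i].
Proof. by rewrite -mesym1_set1 mnm_supp_mesym1. Qed.

Lemma xsetE F : xset K F = 'X_[mesym1 F].
Proof.
rewrite mpolyXE_id /xset big_mkcond; apply: eq_bigr => i _.
by rewrite mnmE; case: (i \in F); rewrite ?expr1 ?expr0.
Qed.

Definition upclosed U := forall F G, F \subset G -> U F -> U G.

(** For [U] closed under supersets this is the squarefree monomial ideal whose complex consists of
    the sets outside [U]. *)
Definition supp_ideal U f := forall m, m \in msupp f -> U (mnm_supp m).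

Lemma supp_idealX U m : supp_ideal U 'X_[m] <-> U (mnm_supp m).
Proof.
split; first by apply; rewrite msuppX mem_head.
by move=> Um m'; rewrite msuppX inE => /eqP->.
Qed.

Lemma supp_ideal_xset U F : supp_ideal U (xset K F) <-> U F.
Proof. by rewrite xsetE supp_idealX mnm_supp_mesym1. Qed.

Lemma supp_ideal_sub U V f :
  (forall F, U F -> V F) -> supp_ideal U f -> supp_ideal V f.
Proof. by move=> UV Uf m /Uf /UV. Qed.

Lemma supp_idealM U V W f g :
  (forall F G, U F -> V G -> (W : pred _) (F :|: G)) ->
  supp_ideal U f -> supp_ideal V g -> supp_ideal W (f * g).
Proof.
move=> UVW Uf Vg m /msuppM_le /allpairsP[[m1 m2] /= [/Uf U1 /Vg V2 ->]].
by rewrite mnm_suppD; apply: UVW.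
Qed.

Lemma supp_idealP U : upclosed U -> ideal (supp_ideal U).
Proof.
move=> upU; split; first by move=> m; rewrite msupp0.
  by move=> f g Uf Ug m /msuppD_le; rewrite mem_cat => /orP[/Uf|/Ug].
move=> h f; apply: (@supp_idealM predT) => [F G _|//].
by apply: upU; apply: subsetUr.
Qed.
Hint Resolve supp_idealP : core.

Lemma ideal_scale J (c : K) f : ideal J -> J f -> J (c *: f).
Proof. by move=> iJ; rewrite -mul_mpolyC; apply: ideal_mull iJ. Qed.

Lemma ideal_mpolyE J f : ideal J ->
  (forall m, m \in msupp f -> J 'X_[m]) -> J f.
Proof.
move=> iJ Jm; rewrite (mpolyE f); apply: ideal_sum => // m /Jm.
exact: ideal_scale.
Qed.

Lemma supp_ideal_min U J f : ideal J ->
  (forall m, U (mnm_supp m) -> J 'X_[m]) -> supp_ideal U f -> J f.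
Proof. by move=> iJ UJ Uf; apply: ideal_mpolyE => // m /Uf /UJ. Qed.

Lemma colon_supp_ideal U m :
  colon (supp_ideal U) 'X_[m] = supp_ideal (fun F => U (mnm_supp m :|: F)).
Proof.
apply: predext => f; rewrite /colon mulrC; split=> Uf m'.
  move=> m'f; rewrite -mnm_suppD; apply: Uf.
  by rewrite (perm_mem (msuppMX _ _)) map_f.
rewrite (perm_mem (msuppMX _ _)) => /mapP[m1 /Uf Um1 ->].
by rewrite mnm_suppD.
Qed.

Lemma mpolyX_dvd m i : i \in mnm_supp m ->
  'X_[m] = 'X_[m - U_(i)] * 'X_i :> {mpoly K[n]}.
Proof.
rewrite inE => mi; rewrite -mpolyXD; congr 'X_[_].
by apply/mnmP => j; rewrite mnmDE mnmBE mnm1E; case: eqP => [<-|]; lia.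
Qed.

Lemma add_gen_supp_ideal U i : upclosed U ->
  add_gen (supp_ideal U) 'X_i = supp_ideal (fun F => U F || (i \in F)).
Proof.
move=> upU; apply: predext => f; split.
  have up' : upclosed (fun F => U F || (i \in F)).
    by move=> F G FG /orP[/(upU _ _ FG)->//|/(subsetP FG)->]; rewrite orbT.
  apply: add_gen_min => //.
  - exact: supp_idealP.
  - by move=> g; apply: supp_ideal_sub => F ->.
  - by apply/supp_idealX; rewrite mnm_suppU set11 orbT.
apply: supp_ideal_min; first exact: add_gen_ideal (supp_idealP upU).
move=> m /orP[Um|im]; first by apply/sub_add_gen/supp_idealX.
by rewrite (mpolyX_dvd im); apply: add_genM (supp_idealP upU).
Qed.

(** [supp_ideal (meets Z)] is the monomial prime generated by the variables in [Z], the kernel of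
    the substitution [kill Z]. *)
Definition meets Z : pred {set 'I_n} := fun F => ~~ [disjoint F & Z].

Lemma upclosed_meets Z : upclosed (meets Z).
Proof. by move=> F G FG; apply/contra/disjointWl. Qed.
Hint Resolve upclosed_meets : core.

Definition kill Z f : {mpoly K[n]} :=
  f \mPo [tuple if i \in Z then 0 else 'X_i | i < n].
HB.instance Definition _ Z := GRing.RMorphism.copy (kill Z)
  (comp_mpoly [tuple if i \in Z then 0 else 'X_i | i < n]).

Lemma killX Z m : kill Z 'X_[m] = if [disjoint mnm_supp m & Z] then 'X_[m] else 0.
Proof.
rewrite /kill comp_mpolyX; case: ifPn => [dZ|].
  rewrite [RHS]mpolyXE_id; apply: eq_bigr => i _.
  rewrite tnth_mktuple; case: ifPn => // iZ.
  move: (disjointFl dZ iZ); rewrite inE => /negbFE/eqP->.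
  by rewrite !expr0.
case/pred0Pn => i /andP[/= im iZ]; rewrite (bigD1 i) //= tnth_mktuple iZ.
by rewrite expr0n; move: im; rewrite inE => /negPf->; rewrite mul0r.
Qed.

Lemma killE Z f :
  kill Z f = \sum_(m <- msupp f) f@_m *: (kill Z 'X_[m]).
Proof. exact: comp_mpolyEX. Qed.

Lemma kill_sub Z f : supp_ideal (meets Z) (f - kill Z f).
Proof.
rewrite killE {1}(mpolyE f) -sumrB; apply: ideal_sum => [|m _].
  exact: supp_idealP.
rewrite -scalerBr; apply: (ideal_scale _ (supp_idealP (@upclosed_meets _))).
rewrite killX; case: ifPn => mZ; first by rewrite subrr => m'; rewrite msupp0.
by rewrite subr0; apply/supp_idealX.
Qed.

Lemma kill_stable Z U f : upclosed U -> supp_ideal U f -> supp_ideal U (kill Z f).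
Proof.
move=> upU Uf; rewrite killE; apply: ideal_sum => [|m /Uf Um].
  exact: supp_idealP.
apply: (ideal_scale _ (supp_idealP upU)).
rewrite killX; case: ifP => _; first exact/supp_idealX.
by move=> m'; rewrite msupp0.
Qed.

Lemma kill_eq0 Z f : supp_ideal (meets Z) f <-> kill Z f = 0.
Proof.
split=> [Zf|kf]; last by have := @kill_sub Z f; rewrite kf subr0.
rewrite killE big_seq big1 // => m /Zf; rewrite killX => /negPf->.
by rewrite scaler0.
Qed.

Lemma killI Z1 Z2 f : kill Z1 (kill Z2 f) = kill (Z1 :|: Z2) f.
Proof.
rewrite [kill Z2 f]killE [RHS]killE raddf_sum; apply: eq_bigr => m _.
rewrite [LHS]comp_mpolyZ; congr (_ *: _); rewrite -/(kill Z1 _) [kill Z2 _]killX.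
rewrite [RHS]killX -(setI_eq0 _ (Z1 :|: Z2)) setIUr setU_eq0 !setI_eq0.
case: ifP => _; first by rewrite killX andbT.
by rewrite andbF raddf0.
Qed.

Lemma kill_var i f : exists a, f - kill [set i] f = a * 'X_i.
Proof.
have := @kill_sub [set i] f; move: (f - _) => g.
have iQ : ideal (fun g : {mpoly K[n]} => exists a, g = a * 'X_i).
  split; first by exists 0; rewrite mul0r.
    by move=> p q [a ->] [b ->]; exists (a + b); rewrite mulrDl.
  by move=> p q [a ->]; exists (p * a); rewrite mulrA.
apply: (supp_ideal_min iQ) => m.
rewrite /meets disjoint_sym disjoints1 negbK => im.
by exists 'X_[m - U_(i)]; apply: mpolyX_dvd.
Qed.

Lemma prime_supp_ideal Z : prime_ideal (supp_ideal (meets Z)).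
Proof.
split; first exact: supp_idealP.
  by rewrite kill_eq0 /kill rmorph1; apply/eqP/oner_neq0.
move=> f g; rewrite !kill_eq0 /kill rmorphM => /eqP.
by rewrite mulf_eq0 => /orP[]/eqP; [left|right].
Qed.

(** * Graded ideals and division by powers of a form *)

Definition homog_ideal J :=
  ideal J /\ forall d f, J f -> J (pihomog mdeg d f).

Lemma mcoeff_pihomog d f m :
  (pihomog mdeg d f)@_m = if mdeg m == d then f@_m else 0.
Proof.
rewrite pihomogE raddf_sum /= -big_filter.
case: ifPn => md; last first.
  rewrite big_seq big1 // => m'; rewrite mem_filter mcoeffZ mcoeffX.
  case/andP=> /eqP m'd _; case: eqP => [m'm|]; last by rewrite mulr0.
  by rewrite -m'm m'd eqxx in md.
have [mf|mf] := boolP (m \in msupp f); last first.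
  rewrite (memN_msupp_eq0 mf) big_seq big1 // => m'.
  rewrite mem_filter mcoeffZ mcoeffX.
  by move=> /andP[_]; case: eqP mf => [->/negPf->//|]; rewrite mulr0.
rewrite (bigD1_seq m) ?filter_uniq ?msupp_uniq ?mem_filter ?md //=.
rewrite mcoeffZ mcoeffX eqxx mulr1 big1 ?addr0 // => m' m'm.
by rewrite mcoeffZ mcoeffX (negPf m'm) mulr0.
Qed.

Lemma homog_supp_ideal U : upclosed U -> homog_ideal (supp_ideal U).
Proof.
move=> upU; split; first exact: supp_idealP.
move=> d f Uf m; rewrite mcoeff_msupp mcoeff_pihomog.
by case: ifP; rewrite ?eqxx // -mcoeff_msupp => _ /Uf.
Qed.

Lemma pihomogM_homog d e f a : f \is d.-homog ->
  pihomog mdeg e (a * f) = if (d <= e)%N then pihomog mdeg (e - d) a * f else 0.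
Proof.
move=> fd; rewrite {1}(pihomog_partitionE (leqnn (msize a))).
rewrite mulr_suml raddf_sum /=.
have H (i : nat) : pihomog mdeg e (pihomog mdeg i a * f) =
    if (i + d == e)%N then pihomog mdeg i a * f else 0.
  have hom : pihomog mdeg i a * f \is (i + d).-homog.
    by apply: dhomogM => //; apply: pihomogP.
  by case: eqP => [<-|/eqP ne]; [apply: pihomog_dE|apply: pihomog_ne0 hom].
rewrite (eq_bigr _ (fun (i : 'I_(msize a)) _ => H i)).
case: ifPn => de; last first.
  by rewrite big1 // => i _; case: eqP => // ie; lia.
have [lt|le] := ltnP (e - d) (msize a).
  rewrite (bigD1 (Ordinal lt)) //= subnK // eqxx big1 ?addr0 // => i ne.
  case: eqP => // ie; case/eqP: ne; apply: val_inj => /=; lia.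
rewrite big1 => [|i _]; last by case: eqP => // ie; have := ltn_ord i; lia.
suff -> : pihomog mdeg (e - d) a = 0 by rewrite mul0r.
apply/mpolyP => m; rewrite mcoeff_pihomog mcoeff0; case: eqP => // md.
by apply/memN_msupp_eq0/msize_mdeg_ge; rewrite md.
Qed.

Lemma homog_add_gen J f d :
  f \is d.-homog -> homog_ideal J -> homog_ideal (add_gen J f).
Proof.
move=> fd [iJ hJ]; split; first exact: add_gen_ideal.
move=> e g [a /(hJ e)]; rewrite raddfB /= (pihomogM_homog _ _ fd).
case: ifP => _ Jg; first by exists (pihomog mdeg (e - d) a).
by exists 0; rewrite mul0r.
Qed.

Lemma mcoeffX_pow_eq0 f k m a :
  f@_0 = 0 -> (mdeg m < k)%N -> (a * f ^+ k)@_m = 0.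
Proof.
move=> f0; elim: k m a => // k IHk m a lt_mk.
rewrite exprS mulrCA mcoeffM big1 // => -[m1 m2] /= /eqP mE.
have [->|m1N0] := eqVneq (m1 : 'X_{1..n}) 0%MM; first by rewrite f0 mul0r.
have := congr1 mdeg mE; rewrite mdegD => md.
by rewrite IHk ?mulr0 //; move: m1N0; rewrite -mdeg_eq0; lia.
Qed.

(** A graded Krull intersection theorem: multiples of [f ^+ i.+1] have no component of degree
    [i]. *)
Lemma homog_ideal_separated J f u : homog_ideal J -> f@_0 = 0 ->
  (forall k, add_gen J (f ^+ k) u) -> J u.
Proof.
move=> [iJ hJ] f0 Ju; rewrite (pihomog_partitionE (leqnn (msize u))).
apply: ideal_sum => // -[i _] _ /=.
have [a /(hJ i)] := Ju i.+1; rewrite raddfB /=.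
suff -> : pihomog mdeg i (a * f ^+ i.+1) = 0 by rewrite subr0.
apply/mpolyP => m; rewrite mcoeff_pihomog mcoeff0; case: eqP => // <-.
by apply: mcoeffX_pow_eq0.
Qed.

Lemma homog_ideal_div J f u : homog_ideal J -> f@_0 = 0 -> ~ J u ->
  exists k u', J (u - f ^+ k * u') /\ ~ add_gen J f u'.
Proof.
move=> hJ f0 nJu; have [iJ _] := hJ; apply: contrapT => H; apply: nJu.
apply: (homog_ideal_separated hJ f0); elim=> [|k [a Ja]].
  by exists u; rewrite expr0 mulr1 subrr; apply: ideal_zero.
have [b Jb] : add_gen J f a.
  by apply: contrapT => nJa; apply: H; exists k, a; rewrite mulrC.
exists b; have -> : u - b * f ^+ k.+1 = (u - a * f ^+ k) + f ^+ k * (a - b * f).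
  by rewrite exprS; ring.
by apply: ideal_add => //; apply: ideal_mull.
Qed.

Definition pos_homog f := f@_0 = 0 /\ exists d, f \is d.-homog.

(** If [w' + a * f] kills some [z] outside [J], factor out of [z] the highest power of [f]: the
    cofactor [z'] is killed by [w'] modulo [J + (f)], against induction. *)
Lemma nonzerodiv_lex_rel J s w H : homog_ideal J ->
  (forall f, f \in s -> pos_homog f) -> wregular J s -> lex_rel H s w ->
  nonzerodiv J w.
Proof.
elim: s J w => [|f s IHs] J w hJ hs /=; have [iJ _] := hJ.
  move=> _ [c cw] h Jh; rewrite -[h]mul1r -cw -mulrA.
  exact: ideal_mull.
move=> [nf ws] [k [a [w' [rw _ ->]]]] z; rewrite -mulrA => Jz.
have [f0 [d fd]] := hs f (mem_head _ _).
have {}Jz : J ((w' + a * f) * z) by apply: nonzerodivX Jz.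
apply: contrapT => /(homog_ideal_div hJ f0)[l [z' [Jzz' nz']]].
apply: nz'; have nw' : nonzerodiv (add_gen J f) w'.
  apply: (IHs _ _ (homog_add_gen fd hJ)) rw => // g gs.
  by apply: hs; rewrite inE gs orbT.
apply: nw'; exists (- (a * z')); apply: (nonzerodivX (k := l) nf).
have -> : f ^+ l * (w' * z' - - (a * z') * f) =
    (w' + a * f) * z - (w' + a * f) * (z - f ^+ l * z') by ring.
by apply: ideal_sub => //; apply: ideal_mull.
Qed.

End SquarefreeIdeals.

(** * Relations between polynomials *)

Section Relations.
Local Open Scope ring_scope.
Variables (K : fieldType) (n : nat).
Implicit Types (m : 'X_{1..n}) (f g h u v w z : {mpoly K[n]}).
Implicit Types (J Q : {mpoly K[n]} -> Prop) (s : seq {mpoly K[n]}).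

Definition is_homog f := exists d, f \is d.-homog.

(** A relation between the members of [rcons s f] other than [x] is a
    nonzerodivisor modulo [x]; this lets one strip off the factors of [g]. *)
Lemma lex_rel_divides s f J g z : homog_ideal J ->
  (forall x, x \in rcons s f -> pos_homog x) -> wregular J (rcons s f) ->
  lex_rel is_homog s g ->
  (forall i, (i < size s)%N -> exists2 w,
     lex_rel (fun=> True) (rcons (take i s ++ drop i.+1 s) f) w &
     add_gen J g (w * z)) ->
  add_gen J g z.
Proof.
elim: s J g z => [|f1 s IHs] J g z hJ; have [iJ _] := hJ.
  move=> _ _ [c cg] _; rewrite -[z]mul1r -cg mulrAC.
  exact: add_genM.
move=> hs /= [nf ws] [k [a [w1 [rw1 [e ghom] ->]]]] Hz.
have hs' x : x \in rcons s f -> pos_homog x.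
  by move=> xs; apply: hs; rewrite inE xs orbT.
have [f10 [d1 f1d]] := hs f1 (mem_head _ _).
have hJ1 := homog_add_gen f1d hJ; have [iJ1 _] := hJ1.
set gamma := w1 + a * f1 in ghom Hz *.
have hJg := homog_add_gen ghom hJ; have [iJg _] := hJg.
have gamma_w1 : add_gen J f1 (gamma - w1).
  by rewrite /gamma addrC addKr; apply: add_genM.
have nw1 : nonzerodiv (add_gen J f1) w1.
  apply: (nonzerodiv_lex_rel hJ1 _ _ rw1) => [x xs|].
    by apply: hs'; rewrite mem_rcons inE xs orbT.
  by move: ws; rewrite -cats1 => /wregular_take.
(* Index [0] of the hypothesis gives a relation without [f1]: a nonzerodivisor modulo [J + (f1)],
   hence modulo [J + (f1 ^+ k)], which contains [g]. *)
have [z1 Jz1] : add_gen J (f1 ^+ k) z.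
  have [w0 rw0 [b Jb]] := Hz 0%N isT; rewrite /= drop0 in rw0.
  apply: (nonzerodiv_add_genX (w := w0) iJ nf).
    exact: (nonzerodiv_lex_rel hJ1 _ ws rw0).
  by exists (b * gamma); move: Jb; congr J; ring.
suff [b Jb] : add_gen J gamma z1.
  exists b; have -> : z - b * (f1 ^+ k * gamma) =
    (z - z1 * f1 ^+ k) + f1 ^+ k * (z1 - b * gamma) by ring.
  by apply: ideal_add => //; apply: ideal_mull.
(* As [gamma] is [w1] modulo [f1], the pair [f1], [gamma] is regular, so [f1] also cancels modulo
   [gamma]. *)
have nfg : nonzerodiv (add_gen J gamma) f1.
  move=> x [y Jy]; have [y1 Jy1] : add_gen J f1 y.
    apply: nw1; have : add_gen J f1 (gamma * y).
      exists x; have -> : gamma * y - x * f1 = - (f1 * x - y * gamma) by ring.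
      exact: ideal_opp.
    have -> : w1 * y = gamma * y - (gamma - w1) * y by ring.
    by move=> H; apply: (ideal_sub iJ1 H); apply: (ideal_mulr _ iJ1).
  exists y1; apply: nf.
  have -> : f1 * (x - y1 * gamma) =
    (f1 * x - y * gamma) + (y - y1 * f1) * gamma by ring.
  by apply: ideal_add => //; apply: ideal_mulr.
(* Divide [z1] by the highest power of [f1] modulo [J + (gamma)]; modulo [f1], where [gamma] becomes
   [w1], induction applies to the cofactor [z2]. *)
apply: contrapT => /(homog_ideal_div hJg f10)[l [z2 [Jz2 nz2]]].
apply: nz2; rewrite add_genAC // (add_gen_congr iJ1 gamma_w1).
apply: IHs => //.
move=> i lt_i; have [w rw [b Jb]] := Hz i.+1 lt_i.
move: rw => /= [k' [a' [wi [rwi _ def_w]]]]; exists wi => //.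
have Jwz1 : add_gen J gamma (w * z1).
  exists b; apply: (nonzerodivX (k := k) nf).
  have -> : f1 ^+ k * (w * z1 - b * gamma) =
    (w * z - b * (f1 ^+ k * gamma)) - w * (z - z1 * f1 ^+ k) by ring.
  by apply: ideal_sub => //; apply: ideal_mull.
have Jz : add_gen J gamma ((wi + a' * f1) * z2).
  apply: (nonzerodivX (k := k') nfg); rewrite mulrA -def_w.
  apply: (nonzerodivX (k := l) nfg).
  have -> : f1 ^+ l * (w * z2) = w * z1 - w * (z1 - f1 ^+ l * z2) by ring.
  by apply: ideal_sub => //; apply: ideal_mull.
rewrite -(add_gen_congr iJ1 gamma_w1) add_genAC //.
exists (- (a' * z2)); move: Jz; congr add_gen; ring.
Qed.

(** * Existence of relations by counting monomials *)

Fixpoint box E k : seq (seq nat) :=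
  if k is k'.+1 then [seq j :: t | j <- iota 0 E, t <- box E k'] else [:: [::]].

Lemma size_box E k : size (box E k) = (E ^ k)%N.
Proof. by elim: k => //= k IHk; rewrite size_allpairs size_iota IHk expnS. Qed.

Lemma mem_box E k t : (t \in box E k) = (size t == k) && all (ltn^~ E) t.
Proof.
elim: k t => [|k IHk] t; first by case: t.
apply/allpairsP/idP => /= [[[j t'] /= []]|].
  by rewrite mem_iota IHk => /= jE /andP[/eqP <- at'] ->; rewrite /= eqxx jE.
case: t => // j t; rewrite /= eqSS andbCA => /andP[jE tE].
by exists (j, t); rewrite mem_iota IHk.
Qed.

Lemma uniq_box E k : uniq (box E k).
Proof.
elim: k => //= k IHk; apply: allpairs_uniq => //; first exact: iota_uniq.
by move=> [j t] [j' t'] _ _ [-> ->].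
Qed.

Fixpoint monom s (t : seq nat) : {mpoly K[n]} :=
  if s is f :: s' then f ^+ head 0%N t * monom s' (behead t) else 1.

Fixpoint weight (d t : seq nat) : nat :=
  if d is e :: d' then (e * head 0 t + weight d' (behead t))%N else 0%N.

Definition lincomb E s (c : seq nat -> K) :=
  \sum_(t <- box E (size s)) c t *: monom s t.

Lemma lincomb_cons E f s c :
  lincomb E (f :: s) c =
  \sum_(0 <= j < E) f ^+ j * lincomb E s (fun t => c (j :: t)).
Proof.
rewrite /lincomb /= big_allpairs_dep /=; rewrite /index_iota subn0.
apply: eq_bigr => j _; rewrite mulr_sumr; apply: eq_bigr => t _.
by rewrite scalerAr.
Qed.

Lemma monom_homog s d t : size d = size s ->
  (forall i, (i < size s)%N -> s`_i \is (nth 0%N d i).-homog) ->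
  monom s t \is (weight d t).-homog.
Proof.
elim: s d t => [|f s IHs] [|e d] t //=; first by move=> _ _; apply: dhomog1.
case=> sd hs; apply: dhomogM; first by apply/dhomogMn/(hs 0%N).
by apply: IHs => // i; apply: (hs i.+1).
Qed.

Lemma pihomog_lincomb s d E c N : size d = size s ->
  (forall i, (i < size s)%N -> s`_i \is (nth 0%N d i).-homog) ->
  pihomog mdeg N (lincomb E s c) =
  lincomb E s (fun t => if weight d t == N then c t else 0).
Proof.
move=> sd hs; rewrite raddf_sum; apply: eq_bigr => t _ /=.
rewrite linearZ /=; have hom := monom_homog t sd hs.
case: eqP => [<-|/eqP ne]; first by rewrite pihomog_dE.
by rewrite (pihomog_ne0 ne hom) scaler0 scale0r.
Qed.

(** The flag [b] lets one construction serve both the graded and the ungraded bounds. *)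
Definition homog_if (b : bool) f := b -> is_homog f.

(** Only the coefficients must not all vanish; the value may be zero. The least exponent [j0] of [f]
    is factored out: its terms give [w], the others a multiple of [f]. If all terms have the same
    weight, each [w + a * f] is homogeneous. *)
Lemma lincomb_lex_rel (b : bool) s d E (c : seq nat -> K) N :
  (b -> size d = size s /\
    forall i, (i < size s)%N -> s`_i \is (nth 0%N d i).-homog) ->
  (b -> forall t, c t != 0 -> weight d t = N) ->
  (exists2 t, t \in box E (size s) & c t != 0) ->
  lex_rel (homog_if b) s (lincomb E s c).
Proof.
elim: s d c N => [|f s IHs] d c N hs cN [t tE ct].
  move: tE ct; rewrite inE => /eqP-> c0.
  exists (c [::])^-1%:MP; rewrite /lincomb big_seq1 /= -mul_mpolyC mulr1.
  by rewrite -mpolyCM mulVf.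
pose P j := has (fun t => c (j :: t) != 0) (box E (size s)).
have exP : exists j, P j.
  move: tE ct; rewrite mem_box; case: t => //= j t /andP[st /andP[_ tE]] ct.
  by exists j; apply/hasP; exists t => //; rewrite mem_box tE andbT.
have [j0 /hasP[t0 t0E ct0] minj] := ex_minnP exP.
have lt_j0 : (j0 < E)%N.
  move: tE ct; rewrite mem_box; case: t => //= j t /and3P[st jE tE] ct.
  apply: leq_ltn_trans jE; apply: minj; apply/hasP; exists t => //.
  by rewrite mem_box tE andbT.
have small j : (j < j0)%N -> lincomb E s (fun t => c (j :: t)) = 0.
  move=> lt_j; rewrite /lincomb big_seq big1 // => u uE.
  have [->|cu] := eqVneq (c (j :: u)) 0; first by rewrite scale0r.
  have /minj : P j by apply/hasP; exists u.
  by rewrite leqNgt lt_j.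
pose w := lincomb E s (fun t => c (j0 :: t)).
pose a := \sum_(j0.+1 <= j < E)
  f ^+ (j - j0.+1) * lincomb E s (fun t => c (j :: t)).
have wa : w + a * f = \sum_(j0 <= j < E)
    f ^+ (j - j0) * lincomb E s (fun t => c (j :: t)).
  rewrite [RHS]big_ltn // subnn expr0 mul1r; congr (_ + _).
  rewrite mulr_suml; apply: eq_big_nat => j /andP[le_j _].
  by rewrite mulrAC -exprSr; congr (f ^+ _ * _); lia.
exists j0, a, w; split.
- apply: (IHs (behead d) _ (N - head 0%N d * j0)%N).
  + move=> /hs[]; case: d {hs cN} => //= e d [sd] hs; split=> // i.
    exact: (hs i.+1).
  + move=> hb u cu; have := cN hb _ cu; have [] := hs hb.
    by case: d {hs cN} => //= e d _ _; lia.
  + by exists t0.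
- move=> hb; have {hs}[sd hs] := hs hb; have {}cN := cN hb.
  exists (N - head 0%N d * j0)%N; rewrite wa big_nat.
  apply: rpred_sum => j /andP[le_j _].
  rewrite /lincomb mulr_sumr; apply: rpred_sum => u _.
  rewrite -scalerAr; have [->|cu] := eqVneq (c (j :: u)) 0.
    by rewrite scale0r rpred0.
  apply: rpredZ; have := cN _ cu.
  case: d sd hs {cN} => //= e d [sd] hs <-.
  have -> : (e * j + weight d u - e * j0 = e * (j - j0) + weight d u)%N.
    by rewrite mulnBr; have := leq_mul (leqnn e) le_j; lia.
  apply: dhomogM; first exact/dhomogMn/(hs 0%N).
  by apply: monom_homog => // i; apply: (hs i.+1).
- rewrite lincomb_cons wa (@big_cat_nat _ _ _ j0) //=; last exact: ltnW.
  rewrite big_nat big1 ?add0r => [|j /andP[_ /small ->]]; last by rewrite mulr0.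
  rewrite mulr_sumr; apply: eq_big_nat => j /andP[le_j _].
  by rewrite mulrA -exprD subnKC.
Qed.

Definition supp_monom (F : {set 'I_n}) (t : seq nat) : 'X_{1..n} :=
  [multinom if i \in F then nth 0%N t (index i (enum F)) else 0%N | i < n].

(** Monomials may be repeated: the list only serves as an upper bound in the count. *)
Definition low_monoms r D : seq 'X_{1..n} :=
  [seq supp_monom F t | F <- enum {set 'I_n}, t <- box D.+1 r].

Lemma size_low_monoms r D : size (low_monoms r D) = (2 ^ n * D.+1 ^ r)%N.
Proof.
rewrite size_allpairs size_box -cardE -cardsT -powersetT card_powerset.
by rewrite cardsT card_ord.
Qed.

Lemma mem_low_monoms r D m : (#|mnm_supp m| <= r)%N -> (mdeg m <= D)%N ->
  m \in low_monoms r D.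
Proof.
move=> mr mD; apply/allpairsP; set F := mnm_supp m.
have le_mD i : (m i <= D)%N.
  by apply: leq_trans mD; rewrite mdegE (bigD1 i) //= leq_addr.
case: (pickP (@predT 'I_n)) => [i0 _|no].
  pose t := mkseq (fun j => if (j < #|F|)%N then m (nth i0 (enum F) j) else 0%N) r.
  exists (F, t); rewrite mem_enum mem_box size_mkseq eqxx /=; split=> //.
    apply/allP => x /mapP[j _ ->] /=; case: ifP => // _; exact: le_mD.
  apply/mnmP => i; rewrite mnmE; case: ifPn => iF; last first.
    by apply/eqP; move: iF; rewrite inE negbK.
  have lt_i : (index i (enum F) < #|F|)%N by rewrite cardE index_mem mem_enum.
  rewrite nth_mkseq ?lt_i ?nth_index ?mem_enum //.
  exact: leq_trans mr.
exists (F, nseq r 0%N); rewrite mem_enum mem_box size_nseq eqxx all_nseq orbT.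
by split=> //; apply/mnmP => i; have := no i.
Qed.

Lemma mdeg_msuppM d e f g :
  (forall m, m \in msupp f -> (mdeg m <= d)%N) ->
  (forall m, m \in msupp g -> (mdeg m <= e)%N) ->
  forall m, m \in msupp (f * g) -> (mdeg m <= d + e)%N.
Proof.
move=> fd ge m /msuppM_le /allpairsP[[m1 m2] /= [/fd m1d /ge m2e ->]].
by rewrite mdegD leq_add.
Qed.

Lemma mdeg_monom s t D E m : (forall f, f \in s -> (msize f <= D.+1)%N) ->
  t \in box E (size s) -> m \in msupp (monom s t) ->
  (mdeg m <= size s * (E * D))%N.
Proof.
have mdeg_1 m' : m' \in msupp (1 : {mpoly K[n]}) -> (mdeg m' <= 0)%N.
  by rewrite msupp1 inE => /eqP->; rewrite mdeg0.
elim: s t m => [|f s IHs] t m sD; first by move=> _ /mdeg_1.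
rewrite mem_box; case: t => // j t /= /and3P[]; rewrite eqSS => st jE tE.
rewrite mulSn; apply: mdeg_msuppM m => m mf; last first.
  apply: IHs mf => [g gs|]; last by rewrite mem_box st.
  by apply: sD; rewrite inE gs orbT.
apply: (@leq_trans (j * D)); last by rewrite leq_mul2r ltnW ?orbT.
elim: j {jE} m mf => [|j IHj] m; first by rewrite expr0 => /mdeg_1.
rewrite exprS mulSn; apply: mdeg_msuppM m => // m /msize_mdeg_lt fm.
have : (msize f <= D.+1)%N by apply: sD; rewrite mem_head.
by move/(leq_trans fm); rewrite ltnS.
Qed.

(** There are [E ^ size s] products with exponents below [E], but in their degrees at most a
    constant times [E ^ r] monomials lie outside [Q]. For large [E] some nontrivial combination
    avoids all of these. *)
Lemma exists_lincomb s Q r : ideal Q -> (r < size s)%N ->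
  (forall m, ~ Q 'X_[m] -> (#|mnm_supp m| <= r)%N) ->
  exists E (c : seq nat -> K),
    (exists2 t, t \in box E (size s) & c t != 0) /\ Q (lincomb E s c).
Proof.
move=> iQ lt_r Qr.
pose D := \max_(f <- s) msize f.
have sD f : f \in s -> (msize f <= D.+1)%N.
  by move=> fs; rewrite leqW // /D (big_rem f) //= leq_maxl.
(* The products have degree at most [B] with [B.+1 <= E * C], and [E] exceeds [2 ^ n * C ^ r], so
   that [2 ^ n * (E * C) ^ r < E ^ r.+1]. *)
pose C := ((size s * D).+1)%N; pose E := (2 ^ n * C ^ r).+1.
pose B := (size s * (E * D))%N.
pose rows := box E (size s); pose cols := low_monoms r B.
have lt_cols : (size cols < size rows)%N.
  rewrite size_low_monoms size_box.
  apply: (@leq_ltn_trans (2 ^ n * (E * C) ^ r)).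
    rewrite leq_mul2l; apply/orP; right.
    case: (r) => // r'; rewrite leq_exp2r // /B /C mulnS [X in (X < _)%N]mulnCA.
    by rewrite -add1n leq_add.
  rewrite expnMn mulnCA.
  apply: (@leq_trans (E ^ r.+1)); last exact: leq_pexp2l.
  by rewrite expnSr ltn_pmul2l ?expn_gt0 // ltnS.
pose A : 'M[K]_(size rows, size cols) :=
  \matrix_(i, j) (monom s (nth [::] rows i))@_(nth 0%MM cols j).
have /rowV0Pn[u uker uN0] : kermx A != 0.
  rewrite kermx_eq0 /row_free neq_ltn.
  by rewrite (leq_ltn_trans (rank_leq_col A) lt_cols).
have uA : u *m A = 0 by apply/sub_kermxP.
pose c t := odflt 0 (omap (u ord0) (insub (index t rows))).
exists E, c; split.
  have [i ui] : exists i, u ord0 i != 0.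
    by move: uN0; case/rV0Pn => i; exists i.
  exists (nth [::] rows i); first exact: mem_nth.
  by rewrite /c index_uniq ?uniq_box // valK.
apply: (ideal_mpolyE iQ) => m mf; apply: contrapT => nQ.
have lincombm : (lincomb E s c)@_m = \sum_(t <- rows) c t * (monom s t)@_m.
  by rewrite raddf_sum; apply: eq_bigr => t _; rewrite /= mcoeffZ.
have mB : (mdeg m <= B)%N.
  rewrite leqNgt; apply/negP => lt_m; move: mf; rewrite mcoeff_msupp lincombm.
  rewrite big_seq big1 ?eqxx // => t tE; rewrite memN_msupp_eq0 ?mulr0 //.
  by apply/negP => /(mdeg_monom sD tE); rewrite leqNgt lt_m.
have mcols : m \in cols by apply: mem_low_monoms => //; apply: Qr.
have lt_m : (index m cols < size cols)%N by rewrite index_mem.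
move: mf; rewrite mcoeff_msupp lincombm; case/eqP.
transitivity ((u *m A) ord0 (Ordinal lt_m)); last by rewrite uA mxE.
rewrite mxE (big_nth [::]) big_mkord; apply: eq_bigr => i _.
by rewrite mxE /= nth_index // /c index_uniq ?uniq_box // valK.
Qed.

End Relations.

(** * Dimension and depth *)

Section DimensionDepth.
Local Open Scope ring_scope.
Variables (K : fieldType) (n : nat).
Implicit Types (m : 'X_{1..n}) (f g h u v w z : {mpoly K[n]}).
Implicit Types (J Q : {mpoly K[n]} -> Prop) (s : seq {mpoly K[n]}).
Implicit Types (E F G Z : {set 'I_n}) (U V : pred {set 'I_n}).

Lemma exists_lex_rel (b : bool) s Q r : ideal Q ->
  (b -> homog_ideal Q /\ forall f, f \in s -> is_homog f) ->
  (r < size s)%N -> (forall m, ~ Q 'X_[m] -> (#|mnm_supp m| <= r)%N) ->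
  exists2 v, lex_rel (homog_if b) s v & Q v.
Proof.
move=> iQ hb lt_r Qr.
have [E [c [[t tE ct] Qc]]] := exists_lincomb iQ lt_r Qr.
case: b hb => [hb|_]; last first.
  exists (lincomb E s c) => //.
  by apply: (@lincomb_lex_rel _ _ _ _ [::] _ _ 0%N) => //; exists t.
have {hb}[[_ hQ] hs] := hb isT.
pose d := [seq (msize f).-1 | f <- s].
have sd : size d = size s by rewrite size_map.
have homs i : (i < size s)%N -> s`_i \is (nth 0%N d i).-homog.
  move=> lt_i; rewrite (nth_map 0) //.
  by have [e /dhomog_msize] := hs _ (mem_nth 0 lt_i).
(* The component of weight [weight d t] still lies in [Q], and it keeps the nonzero coefficient of
   [t]. *)
have := hQ (weight d t) _ Qc; rewrite (pihomog_lincomb _ _ _ sd homs) => Qc'.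
exists (lincomb E s (fun t' => if weight d t' == weight d t then c t' else 0)) => //.
apply: (@lincomb_lex_rel _ _ _ _ d _ _ (weight d t)) => // [_ t' /=|].
  by case: (weight d t' =P _) => // _; rewrite eqxx.
by exists t; rewrite /= ?eqxx.
Qed.

(** Take an element in each difference of consecutive primes. If [d > r], these satisfy a relation
    in [J], hence in the first prime, which [lex_rel_prime_chain] excludes. *)
Lemma prime_chain_quot_le J r d : ideal J ->
  (forall m, ~ J 'X_[m] -> (#|mnm_supp m| <= r)%N) ->
  prime_chain_quot J d -> (d <= r)%N.
Proof.
move=> iJ Jr [P [prP JP sP]]; rewrite leqNgt; apply/negP => lt_r.
pose P' i := P (inord i).
have subP i : (i < d)%N -> strict_sub (P' i) (P' i.+1).
  by move=> lt_i; apply: sP; rewrite !inordK // ltnS // ltnW.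
have /choice[f fP] : forall i, exists f, (i < d)%N -> P' i.+1 f /\ ~ P' i f.
  move=> i; have [/subP[_ [f [Pf nPf]]]|_] := ltnP i d; first by exists f.
  by exists 0.
pose s := mkseq f d.
have sz : size s = d by rewrite size_mkseq.
have [|||v rv Jv] := @exists_lex_rel false s J r iJ => //; first by rewrite sz.
case: (lex_rel_prime_chain (P := P') _ _ _ rv); rewrite ?sz.
- by move=> i _; apply: prP.
- by move=> i g /subP[+ _]; apply.
- by move=> i lt_i; rewrite nth_mkseq //; apply: fP.
- exact: JP.
Qed.

Lemma meetsC F G : meets (~: F) G = ~~ (G \subset F).
Proof. by rewrite /meets disjoints_subset setCK. Qed.

Lemma supp_ideal_meets_le F m :
  ~ supp_ideal (meets (~: F)) ('X_[m] : {mpoly K[n]}) ->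
  (#|mnm_supp m| <= #|F|)%N.
Proof.
by rewrite supp_idealX meetsC => /negP; rewrite negbK => /subset_leq_card.
Qed.

Lemma prime_chain_supp_ideal U F : upclosed U -> ~~ U F ->
  prime_chain_quot (supp_ideal U : {mpoly K[n]} -> Prop) #|F|.
Proof.
move=> upU nUF.
(* Without variables there is no default vertex for [nth]; then [F] is empty and one prime suffices.
   Otherwise the primes are generated by the variables outside [D k], with the vertices of [F]
   dropped one by one. *)
have [i0 _|no] := pickP (@predT 'I_n); last first.
  have -> : #|F| = 0%N by apply: eq_card0 => i; have := no i.
  exists (fun=> supp_ideal (meets (~: F))); split.
  - by move=> _; apply: prime_supp_ideal.
  - move=> _ f; apply: supp_ideal_sub => G UG; rewrite meetsC.
    by apply: contra nUF => GF; apply: upU UG.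
  - by move=> [i lt_i] [j lt_j] /=; lia.
pose D k : {set 'I_n} := [set i in drop k (enum F)].
have DF k : D k \subset F.
  by apply/subsetP => i; rewrite inE => /mem_drop; rewrite mem_enum.
exists (fun k => supp_ideal (meets (~: D k))); split.
- by move=> k; apply: prime_supp_ideal.
- move=> k f; apply: supp_ideal_sub => G UG; rewrite meetsC.
  by apply: contra nUF => GF; apply: upU UG; apply: subset_trans (DF k).
- move=> i j lt_ij; have Dji : D j \subset D i.
    apply/subsetP => k; rewrite !inE.
    have -> : drop j (enum F) = drop (j - i) (drop i (enum F)).
      by rewrite drop_drop subnK // ltnW.
    exact: mem_drop.
  split.
    move=> f; apply: supp_ideal_sub => G; rewrite !meetsC.
    by apply: contra => /subset_trans; apply.
  have lt_i : (i < size (enum F))%N.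
    by rewrite -cardE; have := ltn_ord j; lia.
  pose x := nth i0 (enum F) i.
  have xD k : (x \in D k) = (k <= i)%N.
    rewrite inE; apply/idP/idP => [/(nthP i0)[l]|le_k].
      rewrite size_drop nth_drop => lt_l /eqP.
      rewrite nth_uniq ?enum_uniq //; last by lia.
      by move/eqP=> <-; apply: leq_addr.
    rewrite /x -(subnKC le_k) -nth_drop mem_nth // size_drop ltn_sub2r //.
    exact: leq_ltn_trans lt_i.
  exists 'X_x; rewrite !supp_idealX mnm_suppU !meetsC !sub1set !xD leqnn.
  by rewrite leqNgt lt_ij.
Qed.

Lemma graded_max_idealP f : graded_max_ideal f <-> f@_0 = 0.
Proof.
split.
  case=> s [sX ->]; rewrite raddf_sum /= big_seq big1 // => -[a _] /sX[i /= ->].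
  rewrite -['X_i]expr1; apply: mcoeffX_pow_eq0; last by rewrite mdeg0.
  by rewrite mcoeffX mnm1_eq0.
move=> f0; apply: ideal_mpolyE; first exact: ideal_gen_ideal.
move=> m mf; have /eqP : m != 0%MM.
  by apply: contraTneq mf => ->; rewrite mcoeff_msupp f0 eqxx.
move/eqP; rewrite -mdeg_eq0 mdegE sum_nat_eq0 negb_forall => /existsP[i /= mi].
have im : i \in mnm_supp m by rewrite inE.
rewrite (mpolyX_dvd _ im); apply: ideal_mull; first exact: ideal_gen_ideal.
by apply: ideal_gen_mem; exists i.
Qed.

Lemma homog_regular_seqP J s : ideal J -> homog_regular_seq J s <->
  [/\ forall f, f \in s -> pos_homog f, wregular J s &
      ~ foldl (@add_gen _) J s 1].
Proof.
move=> iJ; rewrite /homog_regular_seq regular_seq_quotP //.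
split=> [[hs [ws ns]]|[hs ws ns]]; split=> //.
  by move=> f /hs[/graded_max_idealP].
by move=> f /hs[f0 hf]; split=> //; apply/graded_max_idealP.
Qed.

(** The sequence lies in the graded maximal ideal, and so does the monomial ideal, since the empty
    set is a face. *)
Lemma homog_regular_proper U s : upclosed U -> ~~ U set0 ->
  (forall f, f \in s -> pos_homog f) ->
  ~ foldl (@add_gen _) (supp_ideal U : {mpoly K[n]} -> Prop) s 1.
Proof.
move=> upU nU0 hs H.
suff /graded_max_idealP : graded_max_ideal (1 : {mpoly K[n]}).
  by rewrite mcoeff1 eqxx => /eqP; rewrite oner_eq0.
move: H; rewrite -ideal_gen_add; last exact: supp_idealP.
apply: ideal_gen_min; first exact: ideal_gen_ideal.
move=> g [Ug|/hs[g0 _]]; last exact/graded_max_idealP.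
apply/graded_max_idealP/eqP; rewrite mcoeff_eq0; apply: contra nU0 => /Ug.
by congr U; apply/setP => i; rewrite !inE mnm0E.
Qed.

Lemma nonzerodiv_supp_ideal U s v H : upclosed U ->
  (forall f, f \in s -> pos_homog f) -> wregular (supp_ideal U) s ->
  lex_rel H s v -> nonzerodiv (supp_ideal U) v.
Proof. by move=> upU; apply: nonzerodiv_lex_rel (homog_supp_ideal K upU). Qed.

(** More than [#|F|] forms have a relation [v] in the prime of [F]. As [F] is a facet, [v] times the
    monomial of [F] lies in the ideal; but [v] is a nonzerodivisor and [F] is a face. *)
Lemma wregular_le_facet U s F : upclosed U -> ~~ U F ->
  (forall i, i \notin F -> U (i |: F)) ->
  (forall f, f \in s -> pos_homog f) -> wregular (supp_ideal U) s ->
  (size s <= #|F|)%N.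
Proof.
move=> upU nUF FU hs ws; rewrite leqNgt; apply/negP => lt_F.
have [||||v rv Fv] := @exists_lex_rel false s (supp_ideal (meets (~: F))) #|F|.
- exact/supp_idealP/upclosed_meets.
- by [].
- by [].
- exact: supp_ideal_meets_le.
have : supp_ideal U (v * xset K F).
  apply: (@supp_idealM _ _ _ (pred1 F)) Fv _; last exact/supp_ideal_xset/eqxx.
  move=> G G' /pred0Pn[i /= /andP[iG]]; rewrite inE => iF /eqP->.
  by apply: upU (FU _ iF); rewrite setSU // sub1set.
by move/(nonzerodiv_supp_ideal upU hs ws rv)/supp_ideal_xset; apply/negP.
Qed.

(** The link of [E] is disconnected, with no edge between [A] and [B]: the
    section of [S/I] around [E] which equals [x_E] on [A] and vanishes on [B]
    does not extend, which bounds the depth. *)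
Lemma wregular_le_link U s E A B : upclosed U -> A :|: B = ~: E ->
  (forall a b, a \in A -> b \in B -> U (a |: (b |: E))) ->
  (exists2 a, a \in A & ~~ U (a |: E)) ->
  (exists2 b, b \in B & ~~ U (b |: E)) ->
  (forall f, f \in s -> pos_homog f) -> wregular (supp_ideal U) s ->
  (size s <= #|E|.+1)%N.
Proof.
move=> upU AB UAB [a aA nUa] [b bB nUb] hs ws; rewrite leqNgt; apply/negP => lt_s.
have hI := homog_supp_ideal K upU; have [iI _] := hI.
have hP := homog_supp_ideal K (@upclosed_meets _ (~: E)); have [iP _] := hP.
(* The [#|E| + 1] forms of [s'] suffice for a relation, and [f] is a spare that replaces any omitted
   one. *)
have [s' [f [ss' sub]]] : exists s' f, size s' = #|E|.+1 /\
    exists s2, s = rcons s' f ++ s2.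
  exists (take #|E|.+1 s), s`_(#|E|.+1); split; first by rewrite size_takel // ltnW.
  by exists (drop #|E|.+2 s); rewrite -take_nth // cat_take_drop.
case: sub => s2 ds.
have {}hs x : x \in rcons s' f -> pos_homog x.
  by move=> xs; apply: hs; rewrite ds mem_cat xs.
have {ws ds} : wregular (supp_ideal U) (rcons s' f).
  by move: ws; rewrite ds => /wregular_take.
move=> ws; have hs' x : x \in s' -> pos_homog x.
  by move=> xs; apply: hs; rewrite mem_rcons inE xs orbT.
have ws' : wregular (supp_ideal U) s'.
  by move: ws; rewrite -cats1 => /wregular_take.
have [|||g rg Pg] := @exists_lex_rel true s' _ #|E| iP.
- by move=> _; split=> // x /hs'[].
- by rewrite ss'.
- exact: supp_ideal_meets_le.
(* This is the part of [w] free of [B]; if [w] is in the prime of [E], all its terms involve [A]. *)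
pose phi w := kill B w.
have phiA w : supp_ideal (meets (~: E)) w -> supp_ideal (meets A) (phi w).
  move/kill_eq0 => kw; suff -> : phi w = phi w - kill A (phi w) by apply: kill_sub.
  by rewrite /phi killI AB kw subr0.
have phiB w : supp_ideal (meets B) (w - phi w) by apply: kill_sub.
have ABI p q : supp_ideal (meets A) p -> supp_ideal (meets B) q ->
    supp_ideal U (p * q * xset K E).
  move=> Ap Bq; rewrite -mulrA.
  pose V F := [exists i in B, (i |: E) \subset F].
  apply: (supp_idealM (V := V) _ Ap).
    move=> F G /pred0Pn[i /= /andP[iF iA]] /exists_inP[j jB jG].
    apply: upU (UAB _ _ iA jB); apply: subset_trans (setUS _ jG) _.
    by rewrite setSU // sub1set.
  apply: (supp_idealM (V := pred1 E) _ Bq); last exact/supp_ideal_xset/eqxx.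
  move=> F G /pred0Pn[i /= /andP[iF iB]] /eqP->; apply/exists_inP; exists i => //.
  by rewrite setSU // sub1set.
have XA : supp_ideal (meets A) ('X_a : {mpoly K[n]}).
  by apply/supp_idealX; rewrite mnm_suppU /meets disjoints1 aA.
have XB : supp_ideal (meets B) ('X_b : {mpoly K[n]}).
  by apply/supp_idealX; rewrite mnm_suppU /meets disjoints1 bB.
have ng := nonzerodiv_supp_ideal upU hs' ws' rg.
(* The section is the fraction of [phi g * xset K E] by [g]. Each relation [w] in the prime of [E]
   multiplies the numerator into the multiples of [g], so [g] divides it. *)
have [h Ih] : add_gen (supp_ideal U) g (phi g * xset K E).
  apply: (@lex_rel_divides _ _ s' f) => //.
    by apply: lex_relW rg => u; apply.
  move=> i; rewrite ss' => lt_i.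
  have [|||w rw Pw] := @exists_lex_rel false
    (rcons (take i s' ++ drop i.+1 s') f) _ #|E| iP.
  - by [].
  - by rewrite size_rcons size_cat size_takel ?size_drop ss' //; lia.
  - exact: supp_ideal_meets_le.
  exists w; [exact: lex_relW rw|exists (phi w * xset K E)].
  have -> : w * (phi g * xset K E) - phi w * xset K E * g =
    phi g * (w - phi w) * xset K E - phi w * (g - phi g) * xset K E by ring.
  by apply: (ideal_sub iI); apply: ABI => //; apply: phiA.
(* Here [h] vanishes on the side of [b]; next, it equals [xset K E] on the side of [a]. Its
   coefficient at the monomial of [E] would then be both [0] and [1]. *)
have Xh : supp_ideal U ('X_b * h).
  apply: ng; have -> : g * ('X_b * h) = phi g * 'X_b * xset K E -
    'X_b * (phi g * xset K E - h * g) by ring.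
  by apply: (ideal_sub iI); [apply: ABI => //; apply: phiA|apply: (ideal_mull _ iI)].
have Xah : supp_ideal U ('X_a * (xset K E - h)).
  apply: ng; have -> : g * ('X_a * (xset K E - h)) =
    'X_a * (g - phi g) * xset K E + 'X_a * (phi g * xset K E - h * g) by ring.
  by apply: (ideal_add iI); [apply: ABI|apply: (ideal_mull _ iI)].
have coefE i (p : {mpoly K[n]}) :
      ~~ U (i |: E) -> supp_ideal U ('X_i * p) -> p@_(mesym1 E) = 0.
  move=> nUi; rewrite -[supp_ideal _ _]/(colon _ _ _) colon_supp_ideal => Up.
  apply: memN_msupp_eq0; apply: contra nUi => /Up.
  by rewrite mnm_suppU mnm_supp_mesym1.
have := coefE _ _ nUa Xah; rewrite mcoeffB (coefE _ _ nUb Xh) xsetE mcoeffX eqxx.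
by rewrite subr0 => /eqP; rewrite oner_eq0.
Qed.

(** * Elementary symmetric polynomials modulo squarefree Veronese ideals *)

Fixpoint elem_sym (L : seq 'I_n) (k : nat) : {mpoly K[n]} :=
  match L, k with
  | _, 0 => 1
  | [::], _ => 0
  | y :: L', k'.+1 => elem_sym L' k'.+1 + 'X_y * elem_sym L' k'
  end.

Lemma elem_sym0 L : elem_sym L 0 = 1. Proof. by case: L. Qed.

(** The resulting ideal is the squarefree Veronese ideal of degree [t.+1] in the variables of
    [L]. *)
Definition veronese (L : seq 'I_n) t : pred {set 'I_n} :=
  fun F => (t < #|F :&: [set:: L]|)%N.

Lemma upclosed_veronese L t : upclosed (veronese L t).
Proof.
move=> F G FG; rewrite /veronese => /leq_trans; apply.
by apply: subset_leq_card; apply: setSI.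
Qed.

Lemma veronese0 L t : (size L <= t)%N -> veronese L t = pred0.
Proof.
move=> Lt; apply/funext => F; apply/negbTE; rewrite -leqNgt.
apply: leq_trans Lt; apply: leq_trans (subset_leq_card (subsetIr _ _)) _.
by rewrite cardsE card_size.
Qed.

Lemma kill_elem_sym L k y : y \notin L -> kill [set y] (elem_sym L k) = elem_sym L k.
Proof.
elim: L k => [|x L IHL] [|k] /=; rewrite ?rmorph0 ?rmorph1 //.
rewrite inE negb_or => /andP[yx yL].
rewrite rmorphD rmorphM /= !IHL // killX mnm_suppU.
by rewrite disjoints1 inE eq_sym yx.
Qed.

Lemma elem_sym_homog L k : elem_sym L k \is k.-homog.
Proof.
elim: L k => [|x L IHL] [|k] /=; rewrite ?dhomog1 ?dhomog0 //.
apply: dhomogD => //; rewrite -add1n; apply: dhomogM => //.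
by rewrite dhomogX /= mdeg1.
Qed.

Lemma veronese_cons y L t F : y \notin L ->
  veronese (y :: L) t (y |: F) = (t < (#|F :&: [set:: L]|).+1)%N.
Proof.
move=> yL; rewrite /veronese.
have -> : (y |: F) :&: [set:: y :: L] = y |: (F :&: [set:: L]).
  apply/setP => i; rewrite !inE; case: eqP => //= _; exact: andbC.
by rewrite cardsU1 !inE (negPf yL) andbF.
Qed.

Lemma elem_sym_veronese L k : uniq L -> supp_ideal (veronese L k) (elem_sym L k.+1).
Proof.
elim: L k => [|y L IHL] k /=; first by move=> _ m; rewrite msupp0.
case/andP=> yL uL.
have iV := @supp_idealP K n _ (@upclosed_veronese (y :: L) k).
apply: (ideal_add iV).
  apply: supp_ideal_sub (IHL k uL) => F; rewrite /veronese => /leq_trans; apply.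
  by apply/subset_leq_card/setIS/subsetP => i; rewrite !inE => ->; rewrite orbT.
rewrite -[supp_ideal _ _]/(colon _ _ _) colon_supp_ideal mnm_suppU.
case: k {iV} => [|k]; first by move=> m _; rewrite veronese_cons.
by apply: supp_ideal_sub (IHL k uL) => F; rewrite veronese_cons.
Qed.

Lemma free_var_veronese L t y : y \notin L ->
  free_var 'X_y (kill [set y]) (supp_ideal (veronese L t) : {mpoly K[n]} -> Prop).
Proof.
move=> yL; split; first exact/supp_idealP/upclosed_veronese.
  by move=> f; apply/kill_stable/upclosed_veronese.
move=> h; rewrite -[supp_ideal _ _]/(colon _ _ _) colon_supp_ideal mnm_suppU.
apply: supp_ideal_sub => F; rewrite /veronese setIUl.
suff -> : [set y] :&: [set:: L] = set0 by rewrite set0U.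
by apply/setP => i; rewrite !inE; case: eqP => // ->; apply/negbTE.
Qed.

Lemma kill_mpolyX y : kill [set y] ('X_y : {mpoly K[n]}) = 0.
Proof. by rewrite killX mnm_suppU disjoints1 set11. Qed.

(** Induction on the variables: the colon by [y] is the ideal of [veronese L t], handled by
    [wregular_add_shift]; adding [y] leaves [veronese L t.+1] with [y] as a free variable, handled
    by induction. *)
Lemma wregular_elem_sym L t : uniq L -> (t <= size L)%N ->
  wregular (supp_ideal (veronese L t)) (map (elem_sym L) (down t)).
Proof.
elim: L t => [|y L IHL] [|t] // /andP[yL uL] le_t.
have fv t' := free_var_veronese t' yL.
have wC : wregular (supp_ideal (veronese L t)) (map (elem_sym (y :: L)) (down t.+1)).
  have -> : map (elem_sym (y :: L)) (down t.+1) =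
      [seq elem_sym L i + 'X_y * elem_sym L i.-1 | i <- down t.+1].
    have : 0%N \notin down t.+1 by elim: (t.+1).
    by elim: (down t.+1) => // -[|i] l IHl //=; rewrite inE => /IHl->.
  apply: (wregular_add_shift _ _ (fv t)) => //.
  - exact: kill_mpolyX.
  - exact: kill_var.
  - by move=> i; apply: kill_elem_sym.
  - exact: elem_sym0.
  - exact: elem_sym_veronese.
  - by apply: IHL.
(* If [t = size L], both ideals are zero and the colon case already gives the claim. *)
move: le_t; rewrite ltnS leq_eqVlt => /predU1P[eq_t|lt_t].
  by rewrite (_ : veronese (y :: L) _ = veronese L t) // !veronese0 //= eq_t.
apply: (@wregular_colon_add _ _ 'X_y); first exact/supp_idealP/upclosed_veronese.
  rewrite colon_supp_ideal mnm_suppU.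
  rewrite (_ : (fun F => _) = veronese L t) //.
  by apply/funext => F; rewrite veronese_cons.
have -> : add_gen (supp_ideal (veronese (y :: L) t.+1)) 'X_y =
    add_gen (supp_ideal (veronese L t.+1)) 'X_y :> ({mpoly K[n]} -> Prop).
  rewrite !add_gen_supp_ideal; try exact: upclosed_veronese.
  congr supp_ideal; apply/funext => F.
  have [yF|yF] := boolP (y \in F); rewrite ?orbT // !orbF /veronese.
  congr (_ < #|pred_of_set _|)%N; apply/setP => i; rewrite !inE.
  by case: eqP => //= ->; rewrite (negPf yF).
have iV := @supp_idealP K n _ (@upclosed_veronese L t.+1).
have iVX := add_gen_ideal 'X_y iV.
apply: (@wregular_map_congr _ _ _ (elem_sym L)) => //.
- move=> [|i] _.
    by rewrite (elem_sym0 L) (elem_sym0 (y :: L)) subrr; apply: ideal_zero iVX.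
  rewrite /= opprD addNKr -mulrN mulrC; exact: (add_genM _ _ iV).
- apply: (wregular_add_var _ _ (fv t.+1)).
  + exact: kill_mpolyX.
  + exact: kill_var.
  + by move=> f /mapP[i _ ->]; apply: kill_elem_sym.
  + exact: IHL.
Qed.

End DimensionDepth.

(** * Matchings in complements of triangle-free graphs *)

Lemma half_even_sum a b k :
  odd a.+1 -> odd b.+1 -> a.+1 + b.+1 = 2 * k -> k.-1 <= a./2 + b./2.
Proof.
move: (odd_double_half a) (odd_double_half b) => /=.
by case: (odd a) => //=; case: (odd b) => //=; lia.
Qed.

Section Matchings.
Variables (T : finType) (e : rel T).
Implicit Types (x y z : T) (A B E F G : {set T}).

Fixpoint has_matching k F : bool :=
  if k is k'.+1 then
    [exists x in F, exists y in F,
       complement e x y && has_matching k' (F :\: [set x; y])]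
  else true.

Lemma has_matchingSP k F :
  reflect (exists x y, [/\ x \in F, y \in F, complement e x y &
                           has_matching k (F :\: [set x; y])])
          (has_matching k.+1 F).
Proof.
apply: (iffP exists_inP) => [[x xF /exists_inP[y yF /andP[xy M]]]|].
  by exists x, y.
case=> x [y [xF yF xy M]]; exists x => //; apply/exists_inP; exists y => //.
by rewrite xy.
Qed.

Lemma has_matchingS k F G : F \subset G -> has_matching k F -> has_matching k G.
Proof.
elim: k F G => // k IHk F G FG /has_matchingSP[x [y [xF yF xy M]]].
apply/has_matchingSP; exists x, y; split; rewrite ?(subsetP FG) //.
by apply: IHk M; apply: setSD.
Qed.

Lemma card_setD2 x y F : x \in F -> y \in F -> x != y ->
  #|F| = (#|F :\: [set x; y]|).+2.
Proof.
move=> xF yF xy; rewrite -(cardsID [set x; y] F) -[in RHS]add2n; congr (_ + _).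
rewrite (setIidPr _) ?cards2 ?xy //.
by apply/subsetP => z /set2P[]->.
Qed.

Lemma has_matching_card k F : has_matching k F -> 2 * k <= #|F|.
Proof.
elim: k F => [|k IHk] F; first by rewrite muln0.
case/has_matchingSP=> x [y [xF yF /andP[xy _] /IHk]].
by rewrite (card_setD2 xF yF xy); lia.
Qed.

Lemma has_matching_leq k l F : k <= l -> has_matching l F -> has_matching k F.
Proof.
elim: l k F => [|l IHl] [|k] F // le_kl /has_matchingSP[x [y [xF yF xy M]]].
by apply/has_matchingSP; exists x, y; split => //; apply: IHl M.
Qed.

Lemma has_matching_tight k F : has_matching k F ->
  exists2 G : {set T}, G \subset F & #|G| = 2 * k /\ has_matching k G.
Proof.
elim: k F => [|k IHk] F; first by exists set0; rewrite ?sub0set ?cards0.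
case/has_matchingSP=> x [y [xF yF xy /IHk[G GF [cG mG]]]].
have xy' : x != y by case/andP: xy.
have GD : (x |: (y |: G)) :\: [set x; y] = G.
  apply/setP => z; rewrite !inE; case: eqP => [->|_] /=.
    by apply/esym/negP => /(subsetP GF); rewrite !inE eqxx.
  case: eqP => [->|_] //=.
  by apply/esym/negP => /(subsetP GF); rewrite !inE eqxx orbT.
exists (x |: (y |: G)).
  rewrite !subUset !sub1set xF yF.
  exact: subset_trans GF (subsetDl _ _).
split; last by apply/has_matchingSP; exists x, y; rewrite GD !inE !eqxx orbT.
rewrite (@card_setD2 x y) // ?GD ?cG ?inE ?eqxx ?orbT //; lia.
Qed.

Lemma matching_has_matching (M : {set {set T}}) F :
  M \subset edges (complement e) -> trivIset M ->
  (forall A, A \in M -> A \subset F) -> has_matching #|M| F.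
Proof.
elim: {M}_.+1 {-2}M F (ltnSn #|M|) => // k IHk M F lt_M Me tM MF.
have [->|[A AM]] := set_0Vmem M; first by rewrite cards0.
have := subsetP Me A AM; rewrite inE => /existsP[x /existsP[y /andP[xy /eqP dA]]].
rewrite (cardsD1 A) AM; apply/has_matchingSP; exists x, y.
have AF := MF A AM.
split=> //; try by apply: (subsetP AF); rewrite dA !inE eqxx ?orbT.
apply: IHk.
- by move: lt_M; rewrite [in X in X -> _](cardsD1 A) AM.
- exact: subset_trans (subsetDl _ _) Me.
- by apply: trivIsetS tM; apply: subsetDl.
- move=> B; rewrite !inE => /andP[BA BM]; rewrite -dA subsetD MF //.
  by move/trivIsetP: tM; apply.
Qed.

Lemma matching_number_has_matching k :
  k <= matching_number (complement e) -> has_matching k [set: T].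
Proof.
rewrite /matching_number => le_k.
have [M /andP[Me tM] eqM] : {M : {set {set T}} |
    (M \subset edges (complement e)) && trivIset M &
    \max_(M : {set {set T}} |
      (M \subset edges (complement e)) && trivIset M) #|M| = #|M|}.
  by apply: eq_bigmax_cond; apply/card_gt0P; exists set0;
     rewrite unfold_in /= sub0set; apply/trivIsetP => A B; rewrite inE.
apply: has_matching_leq (matching_has_matching Me tM _); last first.
  by move=> A _; apply: subsetT.
by rewrite -eqM.
Qed.

(** A part may be empty. *)
Definition bipartition F A :=
  A \subset F /\ {in F &, forall x y, e x y = ((x \in A) != (y \in A))}.

Lemma bipartitionC F A : bipartition F A -> bipartition F (F :\: A).
Proof.
move=> [AF eA]; split; first exact: subsetDl.
move=> x y xF yF; rewrite eA // !inE xF yF !andbT.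
by case: (x \in A); case: (y \in A).
Qed.

Lemma bipartitionS F G A : G \subset F -> bipartition F A ->
  bipartition G (G :&: A).
Proof.
move=> GF [AF eA]; split; first exact: subsetIl.
move=> x y xG yG; rewrite eA ?(subsetP GF) // !inE xG yG //.
Qed.

Lemma card_setD F A : A \subset F -> #|F| = #|A| + #|F :\: A|.
Proof. by move=> AF; rewrite -(cardsID A F) (setIidPr AF). Qed.

(** The complement of a complete bipartite graph consists of two disjoint cliques, and the largest
    matching of a clique leaves at most one vertex uncovered. *)
Lemma bipartition_has_matching F A k : bipartition F A ->
  has_matching k F = (k <= #|A|./2 + #|F :\: A|./2).
Proof.
have side G B x y : bipartition G B -> x \in G -> y \in G -> x != y ->
    x \in B -> y \in B ->
    [/\ bipartition (G :\: [set x; y]) (B :\: [set x; y]),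
        #|B| = (#|B :\: [set x; y]|).+2 &
        (G :\: [set x; y]) :\: (B :\: [set x; y]) = G :\: B].
  move=> bB xG yG xy xB yB; split; last 1 first.
  - apply/setP => z; rewrite !inE; do 2?case: eqP => [->|_] //=.
      by rewrite xB.
    by rewrite yB.
  - have -> : B :\: [set x; y] = (G :\: [set x; y]) :&: B.
      apply/setP => z; rewrite !inE; case: (boolP (z \in B)) => [zB|].
        by rewrite (subsetP (proj1 bB)) ?andbT.
      by rewrite !andbF.
    exact/bipartitionS/bB/subsetDl.
  - exact: card_setD2.
elim: k F A => // k IHk F A bA; apply/has_matchingSP/idP.
  case=> x [y [xF yF /andP[xy nxy] M]].
  move: nxy; rewrite (proj2 bA) // negbK => /eqP exy.
  have [xA|xA] := boolP (x \in A).
    have [bA' cA DA] := side _ _ _ _ bA xF yF xy xA (etrans (esym exy) xA).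
    by move: M; rewrite (IHk _ _ bA') DA cA.
  have bD := bipartitionC bA.
  have xD : x \in F :\: A by rewrite inE xA.
  have yD : y \in F :\: A by rewrite inE -exy xA.
  have [bA' cA DA] := side _ _ _ _ bD xF yF xy xD yD.
  move: M; rewrite (IHk _ _ bA') DA cA setDDr setDv set0U (setIidPr (proj1 bA)).
  by move=> H; rewrite addnS addnC.
wlog gt1A : A bA / 1 < #|A|.
  move=> H; have [gt1|le1] := ltnP 1 #|A|; first exact: H.
  move=> le_k; apply: (H (F :\: A)); first exact: bipartitionC.
    by case: #|A| le1 le_k => [|[|]] //= _; lia.
  by rewrite setDDr setDv set0U (setIidPr (proj1 bA)) addnC.
move/card_gt1P: gt1A => [x [y [xA yA xy]]] le_k.
have [xF yF] : x \in F /\ y \in F by rewrite !(subsetP (proj1 bA)).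
have [bA' cA DA] := side _ _ _ _ bA xF yF xy xA yA.
exists x, y; split=> //; last by rewrite (IHk _ _ bA') DA; move: le_k; rewrite cA.
by rewrite /complement xy (proj2 bA) // xA yA.
Qed.

Hypothesis e_sym : ssrbool.symmetric e.
Hypothesis e_irr : irreflexive e.
Hypothesis e_tri : forall x y z, e x y -> e y z -> e x z -> False.

(** The parity obstruction of Tutte's theorem, which for the complement of a
    triangle-free graph only involves two odd cliques. *)
Lemma perfect_matching_or_odd_bipartition k F : #|F| = 2 * k ->
  has_matching k F \/
  exists A, [/\ bipartition F A, odd #|A| & odd #|F :\: A|].
Proof.
elim: k F => [|k IHk] F cF; first by left.
(* Without a complement edge, [F] is a clique of [e], hence a single edge with two odd parts.
   Otherwise a nonadjacent pair [a], [b] is removed. *)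
have [/exists_inP[a aF /exists_inP[b bF ab]]|noedge] :=
    boolP [exists a in F, exists b in F, complement e a b]; last first.
  have adj x y : x \in F -> y \in F -> x != y -> e x y.
    move=> xF yF xy; apply: contraNT noedge => nxy.
    apply/exists_inP; exists x => //; apply/exists_inP; exists y => //.
    by rewrite /complement xy.
  right; have /card_gt1P[x [y [xF yF xy]]] : 1 < #|F| by lia.
  have eF : F = [set x; y].
    apply/eqP; rewrite eqEsubset !subUset !sub1set xF yF !andbT.
    apply/subsetP => z zF; rewrite !inE.
    case: eqVneq => //= zx; case: eqVneq => //= zy.
    by case: (e_tri (adj _ _ xF yF xy) (adj y z yF zF _) (adj x z xF zF _));
      rewrite eq_sym.
  exists [set x]; rewrite cards1; split=> //.
    split; first by rewrite sub1set.
    move=> u v; rewrite eF => /set2P[]-> /set2P[]->; rewrite !inE ?eqxx ?e_irr //.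
    - by rewrite [y == x]eq_sym (negPf xy); apply: adj.
    - by rewrite e_sym [y == x]eq_sym (negPf xy); apply: adj.
  by move: cF; rewrite (card_setD (A := [set x])) ?sub1set // cards1; lia.
have a_neq_b : a != b by case/andP: ab.
set F' := F :\: [set a; b].
have cF' : #|F'| = 2 * k.
  by move: cF; rewrite (card_setD2 aF bF a_neq_b) -/F'; lia.
have [M|[A [[AF eA] oA oB]]] := IHk F' cF'.
  by left; apply/has_matchingSP; exists a, b.
have F'E z : (z \in F') = [&& z != a, z != b & z \in F].
  by rewrite !inE negb_or andbA.
have a_notin : a \notin F' by rewrite F'E eqxx.
have b_notin : b \notin F' by rewrite F'E eqxx andbF.
have F'F : F' \subset F by apply: subsetDl.
clearbody F'.
have neqF' c x : c \notin F' -> x \in F' -> x != c.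
  by move=> cN xF'; apply: contraNneq cN => <-.
(* With [x] matched to [a] and [y] to [b], both parts that remain are even and contribute the other
   [k.-1] edges. *)
have match2 A1 x y : bipartition F' A1 -> odd #|A1| -> odd #|F' :\: A1| ->
    x \in A1 -> y \in F' :\: A1 -> ~~ e x a -> ~~ e y b -> has_matching k.+1 F.
  move=> bA1 o1 o2 xA yB xa yb.
  have xF' : x \in F' := subsetP (proj1 bA1) x xA.
  have [yF' yA] : y \in F' /\ y \notin A1 by move: yB; rewrite !inE => /andP[].
  have xy : x != y by apply: contraNneq yA => <-.
  pose G := F' :\: [set x; y].
  have GA : G :&: A1 = A1 :\ x.
    apply/setP => z; rewrite in_setI !in_setD in_set2 in_set1.
    have [zA|] := boolP (z \in A1); last by rewrite !andbF.
    rewrite (subsetP (proj1 bA1)) // !andbT negb_or.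
    by rewrite [z == y](_ : _ = false) ?andbT //; apply: contraNF yA => /eqP <-.
  have GB : G :\: (G :&: A1) = (F' :\: A1) :\ y.
    apply/setP => z; rewrite GA !in_setD in_set2 !in_set1.
    by have [->|zx] := eqVneq z x; rewrite ?xA ?andbF //= andbCA.
  have : has_matching k.-1 G.
    rewrite (bipartition_has_matching _ (bipartitionS (subsetDl _ _) bA1)) GB GA.
    apply: half_even_sum; move: o1 o2 cF'; rewrite (card_setD (proj1 bA1)).
    - by rewrite (cardsD1 x A1) xA.
    - by rewrite (cardsD1 y (F' :\: A1)) yB.
    - by rewrite (cardsD1 x A1) xA (cardsD1 y (F' :\: A1)) yB.
  move=> M; have k_gt0 : 0 < k.
    rewrite lt0n; apply: contraTneq xF' => k0.
    by move/eqP: cF'; rewrite k0 muln0 cards_eq0 => /eqP->; rewrite inE.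
  apply/has_matchingSP; exists x, a; split=> //; first exact: (subsetP F'F).
    by rewrite /complement neqF'.
  rewrite -(prednK k_gt0); apply/has_matchingSP; exists y, b; split.
  - by rewrite !inE negb_or eq_sym xy neqF' // (subsetP F'F).
  - by rewrite !inE negb_or bF [b == x]eq_sym neqF' // [b == a]eq_sym a_neq_b.
  - by rewrite /complement neqF'.
  apply: has_matchingS M; apply/subsetP => z.
  rewrite !in_setD !in_set2 !negb_or F'E.
  by case/andP => /andP[-> ->] /and3P[-> -> ->].
(* A vertex with neighbours in both parts would close a triangle. *)
have nbr c A1 : bipartition F' A1 ->
    (forall x, x \in A1 -> ~~ e x c) \/ (forall x, x \in F' :\: A1 -> ~~ e x c).
  move=> [A1F' eA1].
  have [/exists_inP[x xA xc]|/exists_inPn] := boolP [exists x in A1, e x c].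
    right=> y; rewrite inE => /andP[yA yF']; apply/negP => yc.
    apply: (e_tri (y := y) _ yc xc); rewrite eA1 ?xA ?(negPf yA) //.
    exact: (subsetP A1F').
  by left.
have [M|nM] := boolP (has_matching k.+1 F); [by left|right].
have : exists A1, [/\ bipartition F' A1, odd #|A1|, odd #|F' :\: A1| &
    forall x, x \in A1 -> ~~ e x a].
  have [nA|nB] := nbr a A (conj AF eA); first by exists A.
  exists (F' :\: A); split=> //; first exact/bipartitionC.
  by rewrite setDDr setDv set0U (setIidPr AF).
case=> A1 [bA1 o1 o2 nA1a]; set B1 := F' :\: A1 in o2.
have [x0 x0A] : exists x, x \in A1 by apply/card_gt0P; case: #|A1| o1.
have [y0 y0B] : exists y, y \in B1 by apply/card_gt0P; case: #|B1| o2.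
(* Without a matching, [match2] joins [b] to all of [B1], hence to nothing in [A1], and then [a] to
   all of [B1] as well; so [a] and [b] both enlarge the part [A1]. *)
have eB1b y : y \in B1 -> e y b.
  move=> yB; apply: contraNT nM => yb.
  by apply: (match2 A1 x0 y) => //; apply: nA1a.
have nA1b : forall x, x \in A1 -> ~~ e x b.
  by case: (nbr b A1 bA1) => // /(_ _ y0B); rewrite eB1b.
have eB1a y : y \in B1 -> e y a.
  move=> yB; apply: contraNT nM => ya.
  have B1K : F' :\: B1 = A1.
    by rewrite /B1 setDDr setDv set0U (setIidPr (proj1 bA1)).
  apply: (match2 B1 y x0); rewrite ?B1K //; last exact: nA1b.
  exact: bipartitionC.
have BE : F :\: (A1 :|: [set a; b]) = B1.
  by apply/setP => z; rewrite !in_setD in_setU in_set2 F'E !negb_or -!andbA.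
exists (A1 :|: [set a; b]); rewrite BE; split=> //; last first.
  have -> : A1 :|: [set a; b] = a |: (b |: A1).
    by apply/setP => z; rewrite !inE orbC orbA.
  have [aA bA] : a \notin A1 /\ b \notin A1.
    by split; [apply: contra a_notin|apply: contra b_notin];
      apply: (subsetP (proj1 bA1)).
  by rewrite !cardsU1 !inE negb_or a_neq_b aA bA /= negbK.
split.
  rewrite !subUset !sub1set aF bF !andbT.
  exact: subset_trans (proj1 bA1) F'F.
have [A1F' eA1] := bA1.
have B1E x : (x \in B1) = (x \notin A1) && (x \in F') by rewrite inE.
have nab : ~~ e a b by case/andP: ab.
have AA x y : x \in A1 :|: [set a; b] -> y \in A1 :|: [set a; b] -> e x y = false.
  rewrite !in_setU !in_set1 => /or3P[xA|/eqP->|/eqP->] /or3P[yA|/eqP->|/eqP->];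
    apply/negbTE; rewrite ?e_irr //; try by [exact: nA1a|exact: nA1b].
  - by rewrite eA1 ?xA ?yA // (subsetP A1F').
  - by rewrite e_sym nA1a.
  - by rewrite e_sym nA1b.
  - by rewrite e_sym.
have AB x y : x \in A1 :|: [set a; b] -> y \in B1 -> e x y.
  rewrite !in_setU !in_set1 e_sym => /or3P[xA|/eqP->|/eqP->] yB.
  - move: (yB); rewrite B1E => /andP[yA yF'].
    by rewrite eA1 ?xA ?(negPf yA) // (subsetP A1F').
  - exact: eB1a.
  - exact: eB1b.
have BB x y : x \in B1 -> y \in B1 -> e x y = false.
  rewrite !B1E => /andP[/negPf xA xF'] /andP[/negPf yA yF'].
  by rewrite eA1 // xA yA.
have FE x : x \in F -> x \notin A1 :|: [set a; b] -> x \in B1.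
  by move=> xF xN; rewrite -BE inE xN.
move=> x y xF yF.
have [xA|/(FE x xF) xB] := boolP (x \in A1 :|: _);
have [yA|/(FE y yF) yB] := boolP (y \in A1 :|: _) => /=.
- exact: AA.
- exact: AB.
- by rewrite e_sym; apply: AB.
- exact: BB.
Qed.

End Matchings.

(** * Complete bipartite graphs and cardinalities *)

Lemma graph_iso_bipartiteP (T : finType) (e : rel T) i j :
  graph_iso e (@complete_bipartite i j) <->
  exists A, [/\ bipartition e [set: T] A, #|A| = i & #|~: A| = j].
Proof.
split.
  case=> f f_bij eE; pose A := [set x | f x \in [set inl k | k : 'I_i]].
  have inA x : (x \in A) = if f x is inl _ then true else false.
    rewrite inE; case: (f x) => k; first by rewrite imset_f.
    by apply/imsetP => -[].
  have cA : #|A| = i.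
    rewrite -[RHS]card_ord -(card_imset predT (@inl_inj 'I_i 'I_j)).
    rewrite -(on_card_preimset (f := f)) //; exact: onW_bij.
  exists A; split=> //.
    split; first exact: subsetT.
    by move=> x y _ _; rewrite -eE !inA; case: (f x); case: (f y).
  have := cardsC A; rewrite cA (bij_eq_card f_bij) card_sum !card_ord.
  by move/addnI.
case=> A [[_ eA] <- <-].
pose f x : 'I_#|A| + 'I_#|~: A| :=
  match decP (@idP (x \in A)) with
  | left xA => inl (enum_rank_in xA x)
  | right xA => inr (enum_rank_in (introT setCP xA) x)
  end.
pose g (u : 'I_#|A| + 'I_#|~: A|) : T :=
  match u with inl k => enum_val k | inr k => enum_val k end.
have fK : cancel f g.
  move=> x; rewrite /f; case: (decP _) => xA /=.
    by rewrite enum_rankK_in.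
  by rewrite enum_rankK_in // inE; apply/negP.
have gK : cancel g f.
  move=> [k|k]; rewrite /f /g; case: (decP _) => kA.
  - by rewrite enum_valK_in.
  - by case: kA; apply: enum_valP.
  - by have := enum_valP k; rewrite inE kA.
  - by rewrite enum_valK_in.
exists f; first by exists g.
move=> x y; rewrite eA ?inE // /f.
case: (decP _) => xA; case: (decP _) => yA /=.
- by rewrite xA yA.
- by rewrite xA (introF idP yA).
- by rewrite (introF idP xA) yA.
- by rewrite (introF idP xA) (introF idP yA).
Qed.

(** Here [a'], [b'] count a maximal face in parts of sizes [a], [b]. Both are odd: an even part
    could grow unless it is full, and a full even part would already hold [p] edges. As not both
    parts are full, the halves add up to [p - 1]. *)
Lemma half_maximal_sum a b a' b' p : p <= a./2 + b./2 -> a'./2 + b'./2 < p ->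
  a' = a \/ p <= (a'.+1)./2 + b'./2 -> b' = b \/ p <= a'./2 + (b'.+1)./2 ->
  odd a || (2 * p <= a) -> odd b || (2 * p <= b) -> a' + b' = 2 * p.
Proof.
rewrite -![_.+1./2]/(uphalf _) !uphalf_half.
have [Ea Eb] := (odd_double_half a, odd_double_half b).
have [Ea' Eb'] := (odd_double_half a', odd_double_half b').
move: Ea Eb Ea' Eb'; rewrite -!mul2n.
move: (odd a) (odd b) (odd a') (odd b') a./2 b./2 a'./2 b'./2.
by case=> -[] [] [] ha hb ha' hb' /=; lia.
Qed.

Lemma exists_superset (T : finType) (F : {set T}) k : #|F| <= k -> k <= #|T| ->
  exists2 G : {set T}, F \subset G & #|G| = k.
Proof.
move=> le_F le_k; have : k - #|F| <= #|~: F| by have := cardsC F; lia.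
case/card_geqP => s [us ss sF].
exists (F :|: [set:: s]); first exact: subsetUl.
rewrite cardsU cardsE (card_uniqP us) ss.
suff -> : F :&: [set:: s] = set0 by rewrite cards0; lia.
apply/setP => x; rewrite !inE; apply/negP => /andP[xF /sF].
by rewrite inE xF.
Qed.

Lemma exists_subset (T : finType) (F : {set T}) k : k <= #|F| ->
  exists2 G : {set T}, G \subset F & #|G| = k.
Proof.
case/card_geqP => s [us ss sF]; exists [set:: s].
  by apply/subsetP => x; rewrite inE; apply: sF.
by rewrite cardsE (card_uniqP us).
Qed.

(** * Purity in terms of bipartitions *)

Section Purity.
Variables (T : finType) (e : rel T) (p : nat).
Implicit Types (A E F G : {set T}).
Hypothesis e_sym : ssrbool.symmetric e.
Hypothesis e_irr : irreflexive e.
Hypothesis e_tri : forall x y z, e x y -> e y z -> e x z -> False.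

Lemma no_perfect_matchingP F : #|F| = 2 * p ->
  reflect (exists A, [/\ bipartition e F A, odd #|A| & odd #|F :\: A|])
          (~~ has_matching e p F).
Proof.
move=> cF; apply: (iffP idP) => [nM|[A [bA oA oB]]].
  have [M|//] := perfect_matching_or_odd_bipartition e_sym e_irr e_tri cF.
  by rewrite M in nM.
rewrite (bipartition_has_matching _ bA); move: cF; rewrite (card_setD (proj1 bA)).
lia.
Qed.

Hypothesis p_ge2 : 2 <= p.

(** Purity of the complex of sets without [p]-matching, provided that its
    largest faces have [2p] vertices. *)
Definition extendable := forall F, #|F| = 2 * p - 1 ->
  exists2 i, i \notin F & ~~ has_matching e p (i |: F).

(** Nonadjacency is transitive: as [2 * p - 1 >= 3], any three vertices lie in a set whose extension
    is complete bipartite. Triangle-freeness leaves at most two classes, and [A] is that of [u]. *)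
Lemma extendable_bipartite u v : 2 * p <= #|T| -> e u v -> extendable ->
  exists A, [/\ bipartition e [set: T] A, u \in A & v \notin A].
Proof.
move=> le_T uv ext.
have trans x y z : ~~ e x y -> ~~ e y z -> ~~ e x z.
  have [||F xyzF cF] := @exists_superset _ [set x; y; z] (2 * p - 1).
  - apply: (@leq_trans 3); last by lia.
    by apply: leq_trans (leq_card_setU _ _) _; rewrite cards1 cards2; case: eqP.
  - lia.
  have [i iF] := ext F cF; case/no_perfect_matchingP.
    by rewrite cardsU1 iF cF; lia.
  move=> A [[_ eA] _ _].
  have mem t : t \in [set x; y; z] -> t \in i |: F.
    by move=> tx; rewrite inE (subsetP xyzF) ?orbT.
  rewrite !eA ?mem ?inE ?eqxx ?orbT //.
  by case: (x \in A); case: (y \in A); case: (z \in A).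
exists [set x | ~~ e u x]; rewrite !inE uv e_irr; split=> //.
split; first exact: subsetT.
move=> x y _ _; rewrite !inE.
have [ux|ux] := boolP (e u x); have [uy|uy] := boolP (e u y) => /=.
- by apply/negP => xy; apply: e_tri ux xy uy.
- by apply: contraLR ux => xy; apply: trans uy _; rewrite e_sym.
- by apply: contraLR uy => xy; apply: trans ux xy.
- by apply/negbTE; apply: (trans _ u) => //; rewrite e_sym.
Qed.

(** Otherwise enlarge [~: A] to [2 * p - 1] vertices: any further vertex makes both parts even,
    which gives a perfect matching. *)
Lemma extendable_part_size A : bipartition e [set: T] A -> 2 * p <= #|T| ->
  extendable -> ~~ odd #|~: A| -> 2 * p <= #|~: A|.
Proof.
move=> bA le_T ext evB; rewrite leqNgt; apply/negP => lt_B.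
have [F BF cF] := @exists_superset _ (~: A) (2 * p - 1) ltac:(lia) ltac:(lia).
have [i iF] := ext F cF.
rewrite (bipartition_has_matching _ (bipartitionS (subsetT (i |: F)) bA)).
have -> : (i |: F) :\: ((i |: F) :&: A) = ~: A.
  apply/setP => x; rewrite !inE; have [xA|xA] := boolP (x \in A).
    by rewrite andbT andNb.
  by rewrite andbF /= (subsetP BF) ?inE ?orbT.
have := cardsC A; have := cardsID A (i |: F); rewrite cardsU1 iF cF.
have -> : (i |: F) :\: A = ~: A.
  apply/setP => x; rewrite !inE; have [//|xA] := boolP (x \in A).
  by rewrite /= (subsetP BF) ?inE ?orbT.
by lia.
Qed.

Lemma maximal_face_card A F : bipartition e [set: T] A ->
  has_matching e p [set: T] -> ~~ has_matching e p F ->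
  (forall i, i \notin F -> has_matching e p (i |: F)) ->
  (odd #|A| || (2 * p <= #|A|)) -> (odd #|~: A| || (2 * p <= #|~: A|)) ->
  #|F| = 2 * p.
Proof.
move=> bA mT nF maxF hA hB.
have cnt G k : has_matching e k G = (k <= #|G :&: A|./2 + #|G :\: A|./2).
  rewrite (bipartition_has_matching _ (bipartitionS (subsetT G) bA)).
  by rewrite setDIr setDv set0U.
have addA : F :&: A = A \/ p <= (#|F :&: A|.+1)./2 + #|F :\: A|./2.
  have [AF|/subsetPn[i iA iF]] := boolP (A \subset F).
    by left; apply/setIidPr.
  right; have := maxF i iF; rewrite cnt.
  have -> : (i |: F) :&: A = i |: (F :&: A).
    by apply/setP => x; rewrite !inE; case: eqP => [->|].
  have -> : (i |: F) :\: A = F :\: A.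
    by apply/setP => x; rewrite !inE; case: eqP => [->|]; rewrite ?iA ?andbF.
  by rewrite cardsU1 inE (negPf iF).
have addB : F :\: A = ~: A \/ p <= #|F :&: A|./2 + (#|F :\: A|.+1)./2.
  have [AF|/subsetPn[i]] := boolP (~: A \subset F).
    by left; rewrite setDE; apply/setIidPr.
  rewrite inE => iA iF; right; have := maxF i iF; rewrite cnt.
  have -> : (i |: F) :&: A = F :&: A.
    apply/setP => x; rewrite !inE.
    by case: eqP => [->|]; rewrite ?(negPf iA) ?andbF.
  have -> : (i |: F) :\: A = i |: (F :\: A).
    by apply/setP => x; rewrite !inE; case: eqP => [->|]; rewrite ?iA.
  by rewrite cardsU1 inE (negPf iF) andbF.
rewrite -(cardsID A F); apply: (half_maximal_sum (a := #|A|) (b := #|~: A|)) => //.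
- by move: mT; rewrite cnt setTI setTD.
- by rewrite ltnNge -cnt.
- by case: addA => [->|]; [left|right].
- by case: addB => [->|]; [left|right].
Qed.

End Purity.

(** * The squarefree power *)

Section SquarefreePower.
Local Open Scope ring_scope.
Variables (K : fieldType) (n : nat) (Delta : {set {set 'I_n}}).
Hypothesis Delta_complex : simplicial_complex Delta.
Hypothesis Delta_dim1 : complex_dim Delta 1.
Hypothesis Delta_flag : flag K Delta.
Implicit Types (m : 'X_{1..n}) (F G : {set 'I_n}).

Let e := skeleton_graph Delta.

Lemma skeleton_sym : ssrbool.symmetric e.
Proof. by move=> x y; rewrite /e /skeleton_graph eq_sym setUC. Qed.

Lemma skeleton_irr : irreflexive e.
Proof. by move=> x; rewrite /e /skeleton_graph eqxx. Qed.

Lemma complement_skeleton x y : complement e x y -> [set x; y] \notin Delta.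
Proof. by case/andP=> xy; rewrite /e /skeleton_graph xy. Qed.

Lemma upclosed_has_matching k : upclosed (has_matching e k).
Proof. by move=> F G; apply: has_matchingS. Qed.
Hint Resolve upclosed_has_matching : core.

Lemma has_matching1P F :
  reflect (exists x y, [/\ x \in F, y \in F & complement e x y])
          (has_matching e 1 F).
Proof.
apply: (iffP (has_matchingSP _ _ _)) => [[x [y []]]|[x [y []]]];
  by exists x, y.
Qed.

Lemma mpolyX_sub_supp m F (J : {mpoly K[n]} -> Prop) : ideal J ->
  F \subset mnm_supp m -> J (xset K F) -> J 'X_[m].
Proof.
move=> iJ /subsetP Fm; rewrite xsetE => JF.
rewrite (_ : m = (m - mesym1 F + mesym1 F)%MM).
  by rewrite mpolyXD; apply: (ideal_mull _ iJ).
apply/mnmP => i; rewrite mnmDE mnmBE mnmE subnK //.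
by case: (boolP (i \in F)) => // /Fm; rewrite inE lt0n.
Qed.

Lemma SR_ideal_supp : SR_ideal K Delta = supp_ideal [pred F | F \notin Delta].
Proof.
have up : upclosed [pred F | F \notin Delta].
  by move=> F G FG /=; apply: contra => /(proj2 Delta_complex); apply.
apply: predext => f; split.
  apply: ideal_gen_min; first exact: supp_idealP.
  by move=> g [F FN ->]; apply/supp_ideal_xset.
apply: supp_ideal_min; first exact: ideal_gen_ideal.
move=> m mN; apply: (mpolyX_sub_supp _ (subxx _)); first exact: ideal_gen_ideal.
by apply: ideal_gen_mem; exists (mnm_supp m).
Qed.

(** By flagness some nonface inside [F] supports a monomial of degree two; as vertices and the empty
    set are faces, it is a nonedge. *)
Lemma nonface_nonedge F : (F \notin Delta) = has_matching e 1 F.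
Proof.
apply/idP/has_matching1P => [FN|[x [y [xF yF /complement_skeleton]]]]; last first.
  apply: contra => /(proj2 Delta_complex); apply.
  by rewrite subUset !sub1set xF.
apply/has_matching1P; apply/(supp_ideal_xset K).
have : SR_ideal K Delta (xset K F) by rewrite SR_ideal_supp; apply/supp_ideal_xset.
move/Delta_flag; apply: ideal_gen_min; first exact: supp_idealP.
move=> g []; rewrite SR_ideal_supp => gN g2 m mg.
have /= := gN m mg; have md := dhomog_mf g2 mg.
set G := mnm_supp m => GN.
have G0 : set0 \in Delta.
  by have [[F0 F0D _] _] := Delta_dim1; apply: (proj2 Delta_complex) F0D (sub0set _).
have [x xG] : exists x, x \in G.
  by apply/set0Pn; apply: contraNneq GN => ->.
have /subsetPn[y yG] : ~~ (G \subset [set x]).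
  by apply: contra GN; apply/(proj2 Delta_complex)/(proj1 Delta_complex).
rewrite inE eq_sym => xy; apply/has_matching1P; exists x, y; split=> //.
rewrite /complement xy /=; apply: contra GN => /andP[_].
suff -> : G = [set x; y] by [].
apply/eqP; rewrite eq_sym eqEcard subUset !sub1set xG yG cards2 xy /=.
suff : (#|G| <= mdeg m)%N by rewrite md.
rewrite mdegE [leqRHS](bigID (mem G)) /= -sum1_card.
apply: leq_trans (leq_addr _ _); apply: leq_sum => i.
by rewrite inE lt0n.
Qed.

Lemma SR_ideal_matching : SR_ideal K Delta = supp_ideal (has_matching e 1).
Proof.
by rewrite SR_ideal_supp; congr supp_ideal; apply/funext => F;
   apply: nonface_nonedge.
Qed.

Lemma triangle_free x y z : e x y -> e y z -> e x z -> False.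
Proof.
move=> xy yz xz; have : [set x; y; z] \notin Delta.
  apply/negP => /(proj2 Delta_dim1); rewrite leqNgt => /negP; apply.
  rewrite setUC cardsU1 cards2 !inE.
  by case/andP: xy => -> _; case/andP: yz => /negPf yz _;
     case/andP: xz => /negPf xz _; rewrite eq_sym xz eq_sym yz.
rewrite nonface_nonedge => /has_matching1P[u [v [uF vF /andP[uv]]]].
move/negP; apply; move: uF vF uv; rewrite !inE -!orbA.
by do 2![case/or3P=> /eqP->]; rewrite ?eqxx // ?xy ?yz ?xz // skeleton_sym.
Qed.

(** The edges may share vertices, as in ordinary powers of the edge ideal; they are disjoint when
    [m] is squarefree. *)
Fixpoint matching_divides k m : Prop :=
  if k is k'.+1 then
    exists x y m', [/\ complement e x y, m = (U_(x) + U_(y) + m')%MM &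
                       matching_divides k' m']
  else True.

Lemma matching_dividesD k m m' :
  matching_divides k m -> matching_divides k (m + m').
Proof.
elim: k m => //= k IHk m [x [y [m1 [xy -> /IHk m1k]]]].
by exists x, y, (m1 + m')%MM; rewrite addmA.
Qed.

Lemma matching_divides_mdeg k m : matching_divides k m -> (2 * k <= mdeg m)%N.
Proof.
elim: k m => [|k IHk] m /=; first by rewrite muln0.
by case=> x [y [m' [_ -> /IHk]]]; rewrite !mdegD !mdeg1; lia.
Qed.

Lemma matching_divides_squarefree k m :
  squarefree m -> matching_divides k m -> has_matching e k (mnm_supp m).
Proof.
elim: k m => // k IHk m sq [x [y [m' [xy dm km]]]].
have mE i : m i = ((x == i) + (y == i) + m' i)%N by rewrite dm !mnmDE !mnm1E.
apply/has_matchingSP; exists x, y; split=> //.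
- by rewrite inE mE eqxx.
- by rewrite inE mE eqxx addn1.
apply: has_matchingS (IHk m' _ km); last first.
  by move=> i; have := sq i; rewrite mE; lia.
apply/subsetP => i; rewrite !inE => m'i; have := sq i; rewrite mE negb_or.
by rewrite [i == x]eq_sym [i == y]eq_sym; case: (x == i); case: (y == i); lia.
Qed.

Lemma ideal_pow_matching_divides k f m : ideal_pow (SR_ideal K Delta) k f ->
  m \in msupp f -> matching_divides k m.
Proof.
move=> Ik; pose Q k (f : {mpoly K[n]}) :=
  forall m, m \in msupp f -> matching_divides k m.
suff /(_ m) : Q k f by [].
apply: ideal_gen_min Ik.
  split; first by move=> m'; rewrite msupp0.
    by move=> p q pk qk m' /msuppD_le; rewrite mem_cat => /orP[/pk|/qk].
  move=> h p pk m' /msuppM_le /allpairsP[[m1 m2] /= [_ /pk m2k ->]].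
  by rewrite addmC; apply: matching_dividesD.
move=> _ [g [gI ->]]; rewrite /Q; elim: k g gI => // k IHk g gI m'.
rewrite big_ord_recl => /msuppM_le /allpairsP[[m1 m2] /= [m1g m2g ->]].
have := gI ord0; rewrite SR_ideal_matching => /(_ _ m1g).
case/has_matching1P=> x [y [xm ym xy]].
have xy' : x != y by case/andP: xy.
exists x, y, (m1 - (U_(x) + U_(y)) + m2)%MM; split=> //.
  rewrite addmA; congr (_ + _)%MM; apply/mnmP => i.
  rewrite !mnmDE mnmBE mnmDE !mnm1E; move: xm ym; rewrite !inE.
  case: (eqVneq x i) => [<-|_]; case: (eqVneq y _) => [yi|_] //=; try lia.
  - by rewrite yi eqxx in xy'.
  - by rewrite yi; lia.
rewrite addmC; apply: matching_dividesD; apply: (IHk (fun i => g (lift ord0 i))) => //.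
Qed.

Lemma perfect_matching_ideal_pow k F : #|F| = (2 * k)%N -> has_matching e k F ->
  ideal_pow (SR_ideal K Delta) k (xset K F).
Proof.
move=> cF M; apply: ideal_gen_mem.
suff [g gI ->] : exists2 g : nat -> {mpoly K[n]},
    forall i, SR_ideal K Delta (g i) & xset K F = \prod_(i < k) g i.
  by exists (fun i => g i).
elim: k F cF M => [|k IHk] F cF M.
  exists (fun=> 0) => [_|]; first exact: ideal_zero (ideal_gen_ideal _).
  move/eqP: cF; rewrite muln0 cards_eq0 => /eqP->.
  by rewrite /xset big_set0 big_ord0.
case/has_matchingSP: M => x [y [xF yF xy /IHk[|g gI dg]]].
  have xy' : x != y by case/andP: xy.
  by move: cF; rewrite (card_setD2 xF yF xy') mulnS => -[].
exists (fun i => if i is i'.+1 then g i' else xset K [set x; y]).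
  case=> // ; rewrite SR_ideal_matching; apply/supp_ideal_xset/has_matching1P.
  by exists x, y; rewrite !inE !eqxx orbT.
rewrite big_ord_recl -dg /xset (big_setID [set x; y]) /=.
by rewrite (setIidPr _) // subUset !sub1set xF yF.
Qed.

(** The [2 * p] vertices of a [p]-matching give a minimal generator, since the ordinary power
    contains no monomial of degree below [2 * p]. *)
Lemma sqfree_power_matching p :
  sqfree_power (SR_ideal K Delta) p = supp_ideal (has_matching e p).
Proof.
apply: predext => f; split.
  apply: ideal_gen_min; first exact: supp_idealP.
  move=> g [m [-> sq [Im _]]]; apply/supp_idealX.
  apply: matching_divides_squarefree => //.
  by apply: ideal_pow_matching_divides Im _; rewrite msuppX mem_head.
apply: supp_ideal_min; first exact: ideal_gen_ideal.
move=> m /has_matching_tight[F Fm [cF MF]].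
apply: (mpolyX_sub_supp _ Fm); first exact: ideal_gen_ideal.
apply: ideal_gen_mem; exists (mesym1 F); rewrite xsetE; split=> //.
  by move=> i; rewrite mnmE leq_b1.
split; first by rewrite -xsetE; apply: perfect_matching_ideal_pow.
move=> m' Im' le_m'.
have : matching_divides p m'.
  by apply: ideal_pow_matching_divides Im' _; rewrite msuppX mem_head.
move/matching_divides_mdeg; rewrite -cF -mdeg_mesym1 -{1}(submK le_m') mdegD.
rewrite -{2}[mdeg m']add0n leq_add2r leqn0 mdeg_eq0 => /eqP m0.
by rewrite -(submK le_m') m0 add0m.
Qed.

Lemma mem_sqfree_power_complex p F :
  (F \in sqfree_power_complex K Delta p) = ~~ has_matching e p F.
Proof.
rewrite inE sqfree_power_matching; congr negb.
by apply/asboolP/idP => /supp_ideal_xset.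
Qed.

End SquarefreePower.

(** * Facets, purity and Cohen-Macaulayness of the complex *)

Section MainTheorem.
Variables (K : fieldType) (n : nat) (Delta : {set {set 'I_n}}) (p : nat).
Hypothesis Delta_complex : simplicial_complex Delta.
Hypothesis Delta_dim1 : complex_dim Delta 1.
Hypothesis Delta_flag : flag K Delta.
Hypothesis p_ge2 : 2 <= p.
Hypothesis p_le_nu : p <= matching_number (complement (skeleton_graph Delta)).
Hypothesis dim_eq : krull_dim_quot (sqfree_power (SR_ideal K Delta) p) (2 * p).
Implicit Types (A E F G : {set 'I_n}).

Let e := skeleton_graph Delta.
Let e_sym : ssrbool.symmetric e := skeleton_sym Delta.
Let e_irr : irreflexive e := skeleton_irr Delta.
Let e_tri := triangle_free Delta_complex Delta_dim1 Delta_flag.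
Let U := has_matching e p.
Let upU : upclosed U := @upclosed_has_matching _ Delta p.
Let powE := sqfree_power_matching Delta_complex Delta_dim1 Delta_flag p.
Let faceE F : (F \in sqfree_power_complex K Delta p) = ~~ U F :=
  mem_sqfree_power_complex Delta_complex Delta_dim1 Delta_flag p F.

Lemma matching_setT : U setT.
Proof. exact: matching_number_has_matching. Qed.

Lemma face_card_le F : ~~ U F -> #|F| <= 2 * p.
Proof.
move: dim_eq => [_ max]; rewrite powE in max.
by move/(prime_chain_supp_ideal K upU)/max.
Qed.

Lemma exists_top_face : exists2 F, ~~ U F & #|F| = 2 * p.
Proof.
apply: contrapT => noF; move: dim_eq => [chain _]; rewrite powE in chain.
have : 2 * p <= (2 * p).-1; last lia.
apply: prime_chain_quot_le chain; first exact: supp_idealP.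
move=> m; rewrite supp_idealX => /negP nU.
have := face_card_le nU; rewrite leq_eqVlt => /predU1P[cE|]; last by lia.
by case: noF; exists (mnm_supp m).
Qed.

(** The full vertex set has a [p]-matching, so a face with [2 * p] vertices is a proper subset. This
    supplies the bounds on [n] in the classifications. *)
Lemma two_p_lt_n : 2 * p < n.
Proof.
have [F nUF cF] := exists_top_face.
rewrite -cF -[X in _ < X]card_ord ltn_neqAle max_card andbT.
apply: contraNneq nUF => cE; suff -> : F = setT by exact: matching_setT.
by apply/eqP; rewrite eqEcard subsetT cardsT cE /=.
Qed.

Lemma small_face F : #|F| < 2 * p -> ~~ U F.
Proof. by rewrite ltnNge; apply: contra; apply: has_matching_card. Qed.

Lemma facetP F : reflect (~~ U F /\ forall i, i \notin F -> U (i |: F))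
                         (F \in facets (sqfree_power_complex K Delta p)).
Proof.
rewrite inE; apply: (iffP maxsetP) => -[].
  rewrite /= faceE => nUF maxF; split=> // i iF; apply: contraNT iF => nUi.
  by rewrite -(maxF (i |: F)) ?subsetUr ?setU11 //= faceE.
move=> nUF maxF; split; first by rewrite /= faceE.
move=> G; rewrite /= faceE => nUG FG; apply/eqP; rewrite eqEsubset FG andbT.
apply/subsetP => i iG; apply: contraNT nUG => iF.
by apply: upU (maxF i iF); rewrite subUset sub1set iG.
Qed.

Lemma top_facet F : #|F| = 2 * p -> ~~ U F ->
  F \in facets (sqfree_power_complex K Delta p).
Proof.
move=> cF nUF; apply/facetP; split=> // i iF; apply: contraT => /face_card_le.
by rewrite cardsU1 iF cF ltnn.
Qed.

Lemma bipartite_subsetsP F i j :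
  reflect (exists A, [/\ bipartition e F A, #|A| = i & #|F :\: A| = j])
          (F \in bipartite_subsets Delta i j).
Proof.
rewrite inE; apply: (iffP (asboolP _)) => [/graph_iso_bipartiteP|] [A [[AF eA] cA cB]].
  have memA (x : {x | x \in F}) : (val x \in val @: A) = (x \in A).
    exact: (mem_imset _ _ val_inj).
  exists (val @: A); split.
  - split; first by apply/subsetP => _ /imsetP[x _ ->]; apply: valP.
    move=> x y xF yF; have := eA (Sub x xF) (Sub y yF); rewrite !inE -!memA.
    exact.
  - by rewrite (card_imset _ val_inj).
  - rewrite -cB -(card_imset _ val_inj); congr #|pred_of_set _|.
    apply/setP => x; rewrite inE; apply/andP/imsetP => [[xA xF]|[y yA ->]].
      by exists (Sub x xF); rewrite // inE -memA.
    by rewrite memA; move: yA; rewrite inE => ->; split=> //; apply: valP.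
apply/graph_iso_bipartiteP; exists [set x | val x \in A].
have valA : val @: [set x : {x | x \in F} | val x \in A] = A.
  apply/setP => x; apply/imsetP/idP => [[y]|xA]; first by rewrite inE => yA ->.
  by exists (Sub x (subsetP AF x xA)); rewrite ?inE.
have valC : val @: (~: [set x : {x | x \in F} | val x \in A]) = F :\: A.
  apply/setP => x; rewrite inE; apply/imsetP/andP => [[y]|[xA xF]].
    by rewrite !inE => yA ->; split=> //; apply: valP.
  by exists (Sub x xF); rewrite ?inE.
split.
- split; first exact: subsetT.
  by move=> x y _ _; rewrite !inE; apply: eA; apply: valP.
- by rewrite -(card_imset _ val_inj) valA.
- by rewrite -(card_imset _ val_inj) valC.
Qed.

Lemma top_facetsE :
  facets_of_dim (sqfree_power_complex K Delta p) (2 * p - 1) =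
    (if odd p
     then \bigcup_(i < p.+1 | odd i) bipartite_subsets Delta i (2 * p - i)
     else \bigcup_(i < p | odd i) bipartite_subsets Delta i (2 * p - i)).
Proof.
(* For even [p] the parity condition skips the index [p], so both unions may run over [i < p.+1]. *)
have -> : (if odd p
     then \bigcup_(i < p.+1 | odd i) bipartite_subsets Delta i (2 * p - i)
     else \bigcup_(i < p | odd i) bipartite_subsets Delta i (2 * p - i)) =
  \bigcup_(i < p.+1 | odd i) bipartite_subsets Delta i (2 * p - i).
  have [//|evp] := boolP (odd p).
  by rewrite big_mkcond [RHS]big_mkcond big_ord_recr /= (negPf evp) setU0.
apply/setP => F; rewrite inE.
have -> : (#|F| == (2 * p - 1).+1) = (#|F| == 2 * p) by congr (_ == _); lia.
apply/andP/bigcupP => [[/facetP[nUF _] /eqP cF]|[i oi]].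
  have [A [bA oA oB]] := no_perfect_matchingP e_sym e_irr e_tri cF nUF.
  wlog le_A : A bA oA oB / #|A| <= p.
    move=> H; have [le|gt] := leqP #|A| p; first exact: (H A).
    apply: (H (F :\: A)) => //.
    - exact: bipartitionC.
    - by rewrite setDDr setDv set0U (setIidPr (proj1 bA)).
    - move: gt cF; rewrite (card_setD (proj1 bA)).
      by move: #|A| #|F :\: A| => a b; lia.
  have lt_A : #|A| < p.+1 by [].
  exists (Ordinal lt_A) => //; apply/bipartite_subsetsP; exists A; split=> //.
  by move: cF; rewrite (card_setD (proj1 bA)) /= => <-; rewrite addKn.
move/bipartite_subsetsP=> [A [bA cA cB]].
have lt_i := ltn_ord i.
have cF : #|F| = 2 * p by rewrite (card_setD (proj1 bA)) cA cB; lia.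
split; last by rewrite cF.
apply: top_facet => //; apply/(no_perfect_matchingP e_sym e_irr e_tri cF).
exists A; split; rewrite ?cA ?cB //.
by rewrite oddB ?oi ?oddM //; lia.
Qed.

Lemma edge_exists : exists u v, e u v.
Proof.
have [[F FD cF] _] := Delta_dim1.
have /card_gt1P[x [y [xF yF xy]]] : 1 < #|F| by rewrite cF.
exists x, y; rewrite /e /skeleton_graph xy /=; apply: (proj2 Delta_complex) FD _.
by rewrite subUset !sub1set xF.
Qed.

Lemma facet_sup F : ~~ U F ->
  exists2 G : {set 'I_n}, F \subset G & G \in facets (sqfree_power_complex K Delta p).
Proof.
move=> nUF; pose P := [pred G in sqfree_power_complex K Delta p].
have [|G maxG FG] := @maxset_exists _ P F.
  by rewrite /= faceE.
by exists G; rewrite // inE.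
Qed.

(** A top face exists, so purity means that all facets have [2 * p] vertices. A smaller facet lies
    in a set of [2 * p - 1] vertices, and the vertex that extends this set also extends the
    facet. *)
Lemma pure_extendable :
  pure (sqfree_power_complex K Delta p) <-> extendable e p.
Proof.
have [F0 nU0 c0] := exists_top_face; have fF0 := top_facet c0 nU0.
split=> [pureD F cF|ext F1 F2].
  have [|G FG fG] := @facet_sup F; first by apply: small_face; rewrite cF; lia.
  have cG : #|G| = 2 * p by rewrite -c0; apply: pureD.
  have /properP[_ [i iG iF]] : F \proper G by rewrite properEcard FG cF cG /=; lia.
  exists i => //; have [nUG _] := facetP _ fG.
  by apply: contra nUG; apply: upU; rewrite subUset sub1set iG.
suff H E : E \in facets (sqfree_power_complex K Delta p) -> #|E| = 2 * p.
  by move=> /H-> /H->.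
move=> /facetP[nUE maxE]; have := face_card_le nUE.
rewrite leq_eqVlt => /predU1P[//|lt_E].
have [||G EG cG] := @exists_superset _ E (2 * p - 1).
- by rewrite -ltnS (leq_trans lt_E) //; lia.
- by rewrite card_ord; have := two_p_lt_n; lia.
have [i iG nUi] := ext G cG.
have iE : i \notin E by apply: contra iG; apply: (subsetP EG).
case/negP: nUi; apply: upU (maxE i iE); exact: setUS.
Qed.

Lemma pure_bipartite : pure (sqfree_power_complex K Delta p) ->
  exists A, [/\ bipartition e setT A, 0 < #|A|, 0 < #|~: A|,
    odd #|A| || (2 * p <= #|A|) & odd #|~: A| || (2 * p <= #|~: A|)].
Proof.
move/pure_extendable => ext; have [u [v uv]] := edge_exists.
have le_T : 2 * p <= #|'I_n| by rewrite card_ord; have := two_p_lt_n; lia.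
have [A [bA uA vA]] := extendable_bipartite e_sym e_irr e_tri p_ge2 le_T uv ext.
exists A; split=> //.
- by apply/card_gt0P; exists u.
- by apply/card_gt0P; exists v; rewrite inE.
- have bC := bipartitionC bA; rewrite setTD in bC.
  rewrite -implyNb; apply/implyP => evA.
  by have := extendable_part_size p_ge2 bC le_T ext; rewrite setCK; apply.
- rewrite -implyNb; apply/implyP => evA.
  by have := extendable_part_size p_ge2 bA le_T ext; apply.
Qed.

Lemma pure_of_bipartite A : bipartition e setT A ->
  odd #|A| || (2 * p <= #|A|) -> odd #|~: A| || (2 * p <= #|~: A|) ->
  pure (sqfree_power_complex K Delta p).
Proof.
move=> bA hA hB F G /facetP[nUF mF] /facetP[nUG mG].
by rewrite !(maximal_face_card bA matching_setT _ _ hA hB).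
Qed.

Lemma bipartition_iso A a b : bipartition e setT A -> #|A| = a ->
  #|~: A| = b -> graph_iso e (@complete_bipartite a b).
Proof. by move=> bA cA cB; apply/graph_iso_bipartiteP; exists A. Qed.

Lemma bipartition_setC A : bipartition e setT A -> bipartition e setT (~: A).
Proof. by move/bipartitionC; rewrite setTD. Qed.

Lemma odd_halfE a : odd a -> a = 2 * a./2 + 1.
Proof. by move=> oa; rewrite -{1}(odd_double_half a) oa mul2n addnC. Qed.

Lemma even_halfE a : ~~ odd a -> a = 2 * a./2.
Proof. by move/negPf=> oa; rewrite -{1}(odd_double_half a) oa mul2n. Qed.

Lemma pureP : pure (sqfree_power_complex K Delta p) <->
  exists k l : nat,
    [\/ graph_iso e (@complete_bipartite (2 * k + 1) (2 * l + 1)) /\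
         n = (2 * k + 1) + (2 * l + 1) /\ 2 * p <= n,
        graph_iso e (@complete_bipartite (2 * k + 1) (2 * l)) /\ p <= l
      | graph_iso e (@complete_bipartite (2 * k) (2 * l)) /\ p <= k /\ p <= l].
Proof.
split.
  case/pure_bipartite=> A [bA _ _ hA hB].
  have even_le b : ~~ odd b -> odd b || (2 * p <= b) -> p <= b./2.
    by move=> evb; rewrite (negPf evb) {1}(even_halfE evb) leq_pmul2l.
  have := cardsC A; rewrite card_ord => cT.
  (* One case for each pair of parities; the third exchanges the parts to put the odd one first. *)
  have [oA|oA] := boolP (odd #|A|); have [oB|oB] := boolP (odd #|~: A|).
  - exists #|A|./2, #|~: A|./2; constructor 1; rewrite -!odd_halfE // cT.
    by split; [apply: bipartition_iso bA _ _|have := two_p_lt_n; lia].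
  - exists #|A|./2, #|~: A|./2; constructor 2; rewrite -odd_halfE // -even_halfE //.
    by split; [apply: bipartition_iso bA _ _|apply: even_le].
  - exists #|~: A|./2, #|A|./2; constructor 2; rewrite -odd_halfE // -even_halfE //.
    split; last exact: even_le.
    by apply: bipartition_iso (bipartition_setC bA) _ _; rewrite ?setCK.
  - exists #|A|./2, #|~: A|./2; constructor 3; rewrite -!even_halfE //.
    by split; [apply: bipartition_iso bA _ _|split; apply: even_le].
have odd2 x : odd (2 * x) = false by rewrite mul2n odd_double.
have odd2S x : odd (2 * x + 1) by rewrite addn1 /= odd2.
case=> k [l] [] [/graph_iso_bipartiteP[A [bA cA cB]]].
- by move=> _; apply: (pure_of_bipartite bA); rewrite ?cA ?cB odd2S.
- by move=> le_l; apply: (pure_of_bipartite bA); rewrite ?cA ?cB ?odd2S ?leq_mul ?orbT.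
- by case=> le_k le_l; apply: (pure_of_bipartite bA); rewrite ?cA ?cB leq_mul ?orbT.
Qed.

Lemma pos_homog_regular s : homog_regular_seq (supp_ideal U) s <->
  (forall f : {mpoly K[n]}, f \in s -> pos_homog f) /\ wregular (supp_ideal U) s.
Proof.
have iU := @supp_idealP K n _ upU; split.
  by move/(homog_regular_seqP s iU)=> [].
move=> [hs ws]; apply/(homog_regular_seqP s iU); split=> //.
by apply: homog_regular_proper => //; apply: small_face; rewrite cards0; lia.
Qed.

Lemma depth_le_facet d F : depth_quot (sqfree_power (SR_ideal K Delta) p) d ->
  F \in facets (sqfree_power_complex K Delta p) -> d <= #|F|.
Proof.
rewrite powE => -[[s /pos_homog_regular[hs ws] <-] _] /facetP[nUF maxF].
exact: wregular_le_facet ws.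
Qed.

Lemma cm_depth : cohen_macaulay_quot (sqfree_power (SR_ideal K Delta) p) ->
  depth_quot (sqfree_power (SR_ideal K Delta) p) (2 * p).
Proof.
case=> d [chd maxd]; suff -> : d = 2 * p by [].
by apply/eqP; rewrite eqn_leq (proj2 dim_eq) // maxd //; case: dim_eq.
Qed.

Lemma cm_pure : cohen_macaulay_quot (sqfree_power (SR_ideal K Delta) p) ->
  pure (sqfree_power_complex K Delta p).
Proof.
move/cm_depth => dep F G fF fG.
have card2p E : E \in facets (sqfree_power_complex K Delta p) -> #|E| = 2 * p.
  move=> fE; apply/eqP; rewrite eqn_leq (depth_le_facet dep fE) andbT.
  by case/facetP: fE => /face_card_le.
by rewrite !card2p.
Qed.

(** Both parts become even once each receives one more vertex. If [b] is small, [j] is the largest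
    odd number below [b]. *)
Lemma exists_odd_split a b : 2 <= a -> 2 <= b -> 2 * p < a + b ->
  exists i j, [/\ odd i, odd j, i < a, j < b & i + j = 2 * p - 2].
Proof.
move=> a2 b2 ab.
have [le|gt] := leqP (2 * p - 2) b; first by exists 1, (2 * p - 3); split=> //; lia.
have [ob|ob] := boolP (odd b).
  exists (2 * p - b), (b - 2); split; lia.
exists (2 * p - 1 - b), b.-1; split; lia.
Qed.

(** Choose [E] with odd parts [X], [Y] and [2 * p - 2] vertices. Adding a vertex to each part
    creates a perfect matching, while adding only one keeps a face; so the link of [E] is
    disconnected. *)
Lemma cm_star A : bipartition e setT A -> 0 < #|A| -> 0 < #|~: A| ->
  cohen_macaulay_quot (sqfree_power (SR_ideal K Delta) p) ->
  #|A| = 1 \/ #|~: A| = 1.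
Proof.
move=> bipA A0 B0 /cm_depth [[s hs cs] _]; rewrite powE in hs.
have [hom ws] := (pos_homog_regular s).1 hs.
have cT : #|A| + #|~: A| = n by rewrite cardsC card_ord.
apply: contrapT => N.
have [|||i [j [oi oj lti ltj ij]]] := @exists_odd_split #|A| #|~: A|.
- by case: #|A| A0 N => [|[|]] // _ []; left.
- by case: #|~: A| B0 N => [|[|]] // _ []; right.
- by rewrite cT two_p_lt_n.
have [X XA cX] := exists_subset (ltnW lti).
have [Y YB cY] := exists_subset (ltnW ltj).
pose E := X :|: Y.
have YA x : x \in Y -> x \notin A by move/(subsetP YB); rewrite inE.
have AX x : x \in X -> x \in A by move/(subsetP XA).
have XY : X :&: Y = set0.
  by apply/setP => x; rewrite !inE; apply/negP => /andP[/AX xA /YA]; rewrite xA.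
have cE : #|E| = 2 * p - 2 by rewrite cardsU XY cards0 subn0 cX cY.
have := @wregular_le_link K n U s E (A :\: X) (~: A :\: Y) upU.
rewrite cs cE => H; suff : 2 * p <= (2 * p - 2).+1 by lia.
apply: H => //.
- apply/setP => x; rewrite !inE negb_or.
  have [xA|xA] := boolP (x \in A); last first.
    by rewrite andbF andbT /= (contraNN (AX x) xA).
  by rewrite andbF orbF andbT (contraTN (YA x) xA) andbT.
- move=> a b; rewrite !inE => /andP[aX aA] /andP[bY bA'].
  have bA := negbTE bA'.
  rewrite /U (bipartition_has_matching _ (bipartitionS (subsetT _) bipA)).
  set G := a |: _; have -> : G :&: A = a |: X.
    apply/setP => x; rewrite !inE; have [->|_] := eqVneq x a; first by rewrite aA.
    have [->|_] := eqVneq x b; first by rewrite bA andbF /= (contraFF (AX b) bA).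
    have [xX|_] := boolP (x \in X); first by rewrite (AX x xX).
    by apply/negP => /andP[/YA/negP].
  have -> : G :\: (a |: X) = b |: Y.
    apply/setP => x; rewrite !inE negb_or.
    have [->|_] := eqVneq x a.
      rewrite (contraTF (YA a) aA) !orbF; apply/esym/negbTE.
      by apply: contraTneq aA => ->; rewrite bA.
    have [->|_] := eqVneq x b; first by rewrite (contraFF (AX b) bA).
    have [xX|//] := boolP (x \in X).
    by apply/esym/negbTE; apply: contraTN (AX x xX) => /YA.
  rewrite !cardsU1 aX bY cX cY; lia.
- have /properP[_ [a aA aX]] : X \proper A by rewrite properEcard XA cX.
  exists a; first by rewrite inE aX.
  apply: small_face; rewrite cardsU1 cE; case: (_ \notin _) => /=; lia.
- have /properP[_ [b bB bY]] : Y \proper ~: A by rewrite properEcard YB cY.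
  exists b; first by rewrite inE bY.
  apply: small_face; rewrite cardsU1 cE; case: (_ \notin _) => /=; lia.
Qed.

(** The centre [c] is isolated in the complement, so ['X_c] is a free variable. It is followed by
    the elementary symmetric polynomials in the leaves, of degrees [(2 * p).-1] down to [1]. *)
Lemma star_cm A : bipartition e setT A -> #|A| = 1 ->
  cohen_macaulay_quot (sqfree_power (SR_ideal K Delta) p).
Proof.
move=> bA /eqP/cards1P[c dA].
pose L := enum (~: A).
have sL : (size L).+1 = n by rewrite -cardE -[RHS]card_ord -(cardsC A) dA cards1.
have UE : U = veronese L (2 * p).-1.
  apply/funext => F.
  rewrite /U (bipartition_has_matching _ (bipartitionS (subsetT F) bA)).
  have -> : F :\: (F :&: A) = F :&: [set:: L].
    by rewrite set_enum setDIr setDv set0U setDE.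
  rewrite (_ : #|F :&: A|./2 = 0) ?add0n.
    by rewrite /veronese; move: #|_ :&: [set:: L]| => b; apply/idP/idP; lia.
  have : #|F :&: A| <= 1 by rewrite dA -(cards1 c) subset_leq_card // subsetIr.
  by case: #|_| => [|[]].
exists (2 * p) => //; rewrite powE -/U; split; last first.
  move=> s /pos_homog_regular[hs ws].
  have [F nUF cF] := exists_top_face; have := top_facet cF nUF.
  by case/facetP=> _ maxF; rewrite -cF; apply: wregular_le_facet ws.
pose s := ('X_c :: [seq elem_sym K L i | i <- down (2 * p).-1] : seq {mpoly K[n]}).
exists s; last first.
  have size_down k : size (down k) = k by elim: k => //= k ->.
  by rewrite /= size_map size_down prednK //; lia.
apply/pos_homog_regular; split=> [f|].
  rewrite inE => /predU1P[->|/mapP[i id ->]].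
    by split; [rewrite mcoeffX mnm1_eq0|exists 1; rewrite dhomogX /= mdeg1].
  split; last by exists i; apply: elem_sym_homog.
  apply: dhomog_nemf_coeff (elem_sym_homog K L i) _; rewrite /= mdeg0.
  have down0 k : 0 \notin down k by elim: k.
  by case: i id => [|//]; rewrite (negPf (down0 _)).
have cL : c \notin L by rewrite mem_enum inE dA set11.
have fvc := free_var_veronese K (2 * p).-1 cL.
rewrite UE; split; first by case: fvc.
apply: (wregular_add_var _ _ fvc).
- exact: kill_mpolyX.
- exact: kill_var.
- by move=> f /mapP[i _ ->]; apply: kill_elem_sym.
- apply: wregular_elem_sym; first exact: enum_uniq.
  by rewrite -ltnS sL; apply: leq_ltn_trans (leq_pred _) two_p_lt_n.
Qed.

Lemma cohen_macaulayP :
  cohen_macaulay_quot (sqfree_power (SR_ideal K Delta) p) <->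
  graph_iso e (@complete_bipartite 1 (n - 1)) /\ 2 * p < n.
Proof.
split=> [cm|[/graph_iso_bipartiteP[A [bA cA _]] _]]; last exact: star_cm bA cA.
split; last exact: two_p_lt_n.
have [A [bA A0 B0 _ _]] := pure_bipartite (cm_pure cm).
have cT : #|A| + #|~: A| = n by rewrite cardsC card_ord.
have [cA|cB] := cm_star bA A0 B0 cm.
  apply: (bipartition_iso bA cA).
  by move: cT; rewrite cA add1n => /(congr1 predn) /= ->; rewrite subn1.
apply: (bipartition_iso (bipartition_setC bA) cB); rewrite setCK.
by move: cT; rewrite cB addn1 => /(congr1 predn) /= ->; rewrite subn1.
Qed.

End MainTheorem.

Theorem theorem2p5 (K : fieldType) (n : nat) (Delta : {set {set 'I_n}}) (p : nat)
    (Delta_complex : simplicial_complex Delta)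
    (Delta_dim1 : complex_dim Delta 1)
    (Delta_flag : flag K Delta)
    (p_ge2 : 2 <= p)
    (p_le_nu : p <= matching_number (complement (skeleton_graph Delta)))
    (dim_eq : krull_dim_quot (sqfree_power (SR_ideal K Delta) p) (2 * p)) :
  [/\ facets_of_dim (sqfree_power_complex K Delta p) (2 * p - 1) =
        (if odd p
         then \bigcup_(i < p.+1 | odd i) bipartite_subsets Delta i (2 * p - i)
         else \bigcup_(i < p | odd i) bipartite_subsets Delta i (2 * p - i)),
      pure (sqfree_power_complex K Delta p) <->
        exists k l : nat,
          [\/ graph_iso (skeleton_graph Delta)
                (@complete_bipartite (2 * k + 1) (2 * l + 1)) /\
              n = (2 * k + 1) + (2 * l + 1) /\ 2 * p <= n,
              graph_iso (skeleton_graph Delta)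
                (@complete_bipartite (2 * k + 1) (2 * l)) /\
              p <= l
            | graph_iso (skeleton_graph Delta)
                (@complete_bipartite (2 * k) (2 * l)) /\
              p <= k /\ p <= l] &
      cohen_macaulay_quot (sqfree_power (SR_ideal K Delta) p) <->
        graph_iso (skeleton_graph Delta) (@complete_bipartite 1 (n - 1)) /\
        2 * p < n].
Proof.
split; [exact: top_facetsE|exact: pureP|exact: cohen_macaulayP].
Qed.
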